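(* Let $G$ be a linear graph and let $\mathcal W:E(G)\to(0,\infty)$ be a weight function such that $(G,\mathcal W)$ is an unstable positive loaded graph. Then there exists an increasing sequence of positive integers $n_1<n_2<\dots$ such that the sequence of finite subgraphs $G_{n_k,n_{k+1}}\subset G$, $k\ge1$, is irregular relative to $\mathcal W$.
   Context: Graphs and paths. A directed graph $G=(V,E)$ has a finite or countable vertex set $V=V(G)$ and edge set $E=E(G)\subset V\times V$; $(u,w)\in E$ is an edge from $u$ to $w$. A path of length $\ell\ge1$ from $u$ to $w$ is a sequence of $\ell$ consecutive edges starting at $u$ and ending at $w$. $G'$ is a subgraph of $G$ ($G'\subset G$) if $V(G')\subset V(G)$ and $E(G')\subset E(G)$. $G$ is connected if for each ordered pair $u,w$ of vertices there is a path from $u$ to $w$. A simple $u$-cycle is a path from $u$ to $u$ that visits $u$ only at its beginning and its end; $\ell(\gamma)$ denotes the length of $\gamma$. Linear graph. A linear graph is a directed graph $G$ with $V(G)=\mathbb N=\{1,2,\dots\}$ and $E(G)=E_1\cup E_2$, where $E_1$ consists of all pairs $(i,1)$ and $(i,i+1)$, $i\in\mathbb N$, and $E_2$ is some set of pairs $(i,j)$ with $i<j-1$ such that for each $i$ there are only finitely many $j$ with $(i,j)\in E_2$. Put $v:=1$. Subgraphs. For a family $\Gamma$ of paths in $G$, $G(\Gamma)$ is the minimal subgraph of $G$ containing all paths from $\Gamma$. $\Gamma_\ell$ is the family of all simple $v$-cycles of length $\ell$ in $G$. For $m>n\ge1$, $G_{n,m}:=G\big((\bigcup_{\ell\le n}\Gamma_\ell)\cup\Gamma_m\big)$;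 this is a finite connected graph. Loaded graphs. A loaded graph is a pair $(G,\mathcal W)$ with $\mathcal W:E(G)\to(0,\infty)$; the weight $\mathcal W(\gamma)$ of a path is the product of the weights of its edges. For a vertex $u$ let $q_u(n)$ be the sum of the weights of all simple $u$-cycles of length $n$, $\Phi_{u,u|u}(G,\mathcal W,z)=\sum_{n\ge1}q_u(n)z^n$ ($z\ge 0$), and let $R_u$ be the radius of convergence of this series; it is assumed that $R_u>0$. $(G,\mathcal W)$ ($G$ connected) is unstable positive if for some vertex $u$ one has $\Phi_{u,u|u}(G,\mathcal W,R_u)=1$ and $\frac{d}{dz}\Phi_{u,u|u}(G,\mathcal W,z)|_{z=R_u}=\sum_{n\ge1} nq_u(n)R_u^{n-1}<\infty$ (equivalently, this holds for all vertices $u$). Equilibrium measures of finite subgraphs. Let $G'$ be a finite connected subgraph of $G$, loaded with the restriction of $\mathcal W$. Let $A$ be the $V(G')\times V(G')$ matrix with entries $A(u,w)=\mathcal W(u,w)$ if $(u,w)\in E(G')$ and $0$ otherwise, $\lambda>0$ its Perron eigenvalue, and $l,r$ positive vectors with $lA=\lambda l$, $Ar=\lambda r$, $\sum_u l_ur_u=1$. The equilibrium measure $\mu^{G',\mathcal W}$ is the shift-invariant Markov probability measure on two-sided infinite paths given by $\mu^{G',\mathcal W}(\omega_s=u_0,\dots,\omega_{s+t}=u_t)=\lambda^{-t}l_{u_0}\prod_{i=0}^{t-1}A(u_i,u_{i+1})\,r_{u_t}$ (it is the unique maximizer of $\mu\mapsto h_\mu+\int\log\mathcal W(\omega_0,\omega_1)\,d\mu$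 over shift-invariant probability measures on the path space of $G'$). It is regarded as a measure on $\Omega(G)=\{(\omega_i)_{i\in\mathbb Z}:(\omega_i,\omega_{i+1})\in E(G)\ \forall i\}$. Irregular sequences. A sequence of subgraphs $H_k$ of $G$ is exhaustive if $H_k\subset H_{k+1}$ for all $k$, $\bigcup_kV(H_k)=V(G)$ and $\bigcup_kE(H_k)=E(G)$. An exhaustive sequence of finite connected subgraphs $H_k$ is irregular relative to $\mathcal W$ if $\mu^{H_k,\mathcal W}$ converges to the zero measure as $k\to\infty$, i.e. $\mu^{H_k,\mathcal W}(C)\to0$ for every cylinder set $C=\{\omega\in\Omega(G):\omega_s=u_0,\dots,\omega_{s+t}=u_t\}$. *)

(* Defs.v *)
From HB Require Import structures.
From mathcomp Require Import all_boot all_order all_algebra.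
From mathcomp Require Import all_classical all_reals all_analysis.
From mathcomp Require Import complex.

Set Implicit Arguments.
Unset Strict Implicit.
Unset Printing Implicit Defensive.

Import Order.TTheory GRing.Theory Num.Theory.
Import numFieldNormedType.Exports.

Local Open Scope classical_set_scope.
Local Open Scope ring_scope.

(* Finite or countable directed graphs, with vertices numbered by naturals. *)
Record digraph := Digraph {
  vset : set nat;
  eset : set (nat * nat);
  esetP : forall e, eset e -> vset e.1 /\ vset e.2 }.

Definition subgraph (G' G : digraph) :=
  vset G' `<=` vset G /\ eset G' `<=` eset G.

(* A path is encoded by its starting point and the list of the endpoints of
   its successive edges; its length is the size of that list. *)
Definition gpath : Type := nat * seq nat.

Definition visited (g : gpath) : seq nat := g.1 :: g.2.
Definition path_edges (g : gpath) : seq (nat * nat) := zip (visited g) g.2.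
Definition path_length (g : gpath) : nat := size g.2.

Definition is_path (G : digraph) (u w : nat) (g : gpath) : Prop :=
  [/\ g.1 = u, last g.1 g.2 = w, (0 < path_length g)%N &
      forall e, e \in path_edges g -> eset G e].

Definition connected_graph (G : digraph) : Prop :=
  forall u w, vset G u -> vset G w -> exists g, is_path G u w g.

Definition finite_graph (G : digraph) : Prop := finite_set (vset G).

Definition simple_cycle (G : digraph) (u : nat) (g : gpath) : Prop :=
  is_path G u u g /\
  forall i, (0 < i < path_length g)%N -> nth 0%N (visited g) i <> u.

Definition simple_cycles (G : digraph) (u n : nat) : set gpath :=
  [set g | simple_cycle G u g /\ path_length g = n].

Section generated.
Variable Gamma : set gpath.

Let V : set nat := [set x | exists2 g, Gamma g & x \in visited g].
Let E : set (nat * nat) := [set e | exists2 g, Gamma g & e \in path_edges g].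

Lemma generated_esetP e : E e -> V e.1 /\ V e.2.
Proof.
case: e => x y [g Gg] xy; split; exists g => //=.
- by apply: (mem_subseq (s1 := unzip1 (path_edges g))); 
    [rewrite /path_edges/visited; move: (g.1) (g.2) => a s;
     elim: s a => //= b s IH a; rewrite eqxx; exact: IH
    |apply/mapP; exists (x, y)].
- rewrite /visited in_cons; apply/orP; right.
  suff <- : unzip2 (path_edges g) = g.2 by apply/mapP; exists (x, y).
  by rewrite /path_edges/visited unzip2_zip //= leqW.
Qed.

Definition generated_subgraph : digraph := Digraph generated_esetP.

End generated.

(* [generated_subgraph Gamma] is the least graph containing all the paths of
   [Gamma]. *)
Lemma generated_subgraph_path (Gamma : set gpath) (G : digraph) u w g :
  Gamma g -> is_path G u w g -> is_path (generated_subgraph Gamma) u w g.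
Proof. by move=> Gg [? ? ? _]; split => // e eg; exists g. Qed.

Lemma generated_subgraph_least (Gamma : set gpath) (G : digraph) :
  (forall g, Gamma g -> exists u w, is_path G u w g) ->
  subgraph (generated_subgraph Gamma) G.
Proof.
move=> GG; split=> [x [g /[dup] Gg /GG[u [w [_ _ g0 gE]]]] xg|e [g /GG]].
  suff [y []] : exists y, (x, y) \in path_edges g \/ (y, x) \in path_edges g.
  - by move/gE/esetP => -[].
  - by move/gE/esetP => -[].
  case: g {Gg} g0 gE xg => a [//|b s] _ _.
  rewrite /visited/path_edges/= inE => /predU1P[->|].
    by exists b; left; rewrite mem_head.
  elim: s a b => [|c s IH] a b.
    by rewrite mem_seq1 => /eqP ->; exists a; right; rewrite mem_head.
  rewrite inE => /predU1P[->|/(IH b)[y H]].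
    by exists a; right; rewrite mem_head.
  by exists y; case: H => H; [left|right]; rewrite inE H orbT.
by case=> u [w [_ _ _ gE]] /gE.
Qed.

(* The edges (i, j) with i < j - 1 form the set E2. *)
Definition linear_graph (G : digraph) : Prop :=
  vset G = [set i | (0 < i)%N] /\
  exists E2 : set (nat * nat),
    [/\ forall i j, E2 (i, j) -> (0 < i)%N /\ (i.+1 < j)%N,
        forall i, finite_set [set j | E2 (i, j)] &
        eset G = [set e | exists2 i, (0 < i)%N & e = (i, 1%N)] `|`
                 [set e | exists2 i, (0 < i)%N & e = (i, i.+1)] `|` E2].

(* The subgraph G_{n,m} of a linear graph G, with distinguished vertex v = 1. *)
Definition Gnm (G : digraph) (n m : nat) : digraph :=
  generated_subgraph ((\bigcup_(l in [set l | (l <= n)%N])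
    simple_cycles G 1 l) `|` simple_cycles G 1 m).

Section loaded.
Variable R : realType.
Implicit Types (G H : digraph) (W : nat * nat -> R).

Definition path_weight W (g : gpath) : R := \prod_(e <- path_edges g) W e.

Local Open Scope ereal_scope.

Definition q_ G W (u n : nat) : \bar R :=
  \esum_(g in simple_cycles G u n) (path_weight W g)%:E.

Definition Phi G W (u : nat) (z : R) : \bar R :=
  \sum_(1 <= n <oo) q_ G W u n * (z ^+ n)%:E.

Definition Phi_deriv G W (u : nat) (z : R) : \bar R :=
  \sum_(1 <= n <oo) n%:R%:E * q_ G W u n * (z ^+ n.-1)%:E.

(* The coefficients are nonnegative, so that it is enough to look at the
   nonnegative points of convergence. *)
Definition conv_radius G W (u : nat) : \bar R :=
  ereal_sup [set z%:E | z in [set z : R | (0 <= z)%R /\ Phi G W u z < +oo]].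

(* Only the values of W on the edges of G are relevant. *)
Definition loaded_graph G W : Prop :=
  (forall e, eset G e -> (0 < W e)%R) /\
  (forall u, vset G u -> 0 < conv_radius G W u).

Definition unstable_positive G W : Prop :=
  connected_graph G /\
  exists2 u, vset G u &
    exists r : R, [/\ conv_radius G W u = r%:E,
                      Phi G W u r = 1 & Phi_deriv G W u r < +oo].

Local Close Scope ereal_scope.

Definition adj H W (u w : nat) : R :=
  if (u, w) \in eset H then W (u, w) else 0.

(* Complex eigenvalues of the V(H) x V(H) matrix [adj H W]. *)
Definition adj_eigenvalue H W (c : R[i]) : Prop :=
  exists x : nat -> R[i],
    (exists2 u, vset H u & x u != 0) /\
    forall u, vset H u ->
      \sum_(w \in vset H) real_complex R (adj H W u w) * x w = c * x u.

Definition perron_eigenvalue H W (lambda : R) : Prop :=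
  [/\ 0 < lambda, adj_eigenvalue H W (real_complex R lambda) &
      forall c, adj_eigenvalue H W c -> `|c| <= real_complex R lambda].

(* Bi-infinite sequences of vertices with the product sigma-algebra. *)
Definition coord_cylinder (s : int) (t : nat) (u : nat -> nat) :
    set (int -> nat) :=
  [set omega | forall i, (i <= t)%N -> omega (s + i%:Z) = u i].

Definition path_space : Type :=
  g_sigma_algebraType [set C | exists s t u, C = coord_cylinder s t u].

HB.instance Definition _ := Measurable.on path_space.

Definition Omega G : set path_space :=
  [set omega | forall i : int, eset G (omega i, omega (i + 1))].

Definition cylinder G (s : int) (t : nat) (u : nat -> nat) : set path_space :=
  Omega G `&` coord_cylinder s t u.

(* Measures on Omega(H) are seen as measures on all sequences that are carried
   by Omega(H).  The formula for the cylinders forces shift-invariance and the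
   Markov property. *)
Definition equilibrium_measure H W (mu : probability path_space R) : Prop :=
  mu (Omega H) = 1%E /\
  exists lambda (l r : nat -> R),
    [/\ perron_eigenvalue H W lambda,
        forall u, vset H u -> 0 < l u /\ 0 < r u,
        forall w, vset H w ->
          \sum_(u \in vset H) l u * adj H W u w = lambda * l w /\
          \sum_(u \in vset H) adj H W w u * r u = lambda * r w,
        \sum_(u \in vset H) l u * r u = 1 &
        forall s t (u : nat -> nat), (forall i, (i <= t)%N -> vset H (u i)) ->
          mu (cylinder H s t u) =
          (lambda ^- t * l (u 0%N) *
           (\prod_(i < t) adj H W (u i) (u i.+1)) * r (u t))%:E].

Definition exhaustive G (H : nat -> digraph) : Prop :=
  [/\ forall k, subgraph (H k) G,
      forall k, subgraph (H k) (H k.+1),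
      \bigcup_k vset (H k) = vset G &
      \bigcup_k eset (H k) = eset G].

Definition irregular G W (H : nat -> digraph) : Prop :=
  [/\ exhaustive G H,
      forall k, finite_graph (H k) /\ connected_graph (H k) &
      exists mu : nat -> probability path_space R,
        (forall k, equilibrium_measure (H k) W (mu k)) /\
        forall s t u, mu k (cylinder G s t u) @[k --> \oo] --> 0%E].

End loaded.

(* Main.v *)
From HB Require Import structures.
Require Import Defs.
From mathcomp Require Import all_boot all_order all_algebra.
From mathcomp Require Import all_classical all_reals all_analysis.
From mathcomp Require Import complex zify ring lra.

Set Implicit Arguments.
Unset Strict Implicit.
Unset Printing Implicit Defensive.

Import Order.TTheory GRing.Theory Num.Theory.
Import numFieldNormedType.Exports.

(** Write A for the weighted adjacency matrix of the linear graph G and q(l) for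
    the total weight of the simple 1-cycles of length l.  A vertex of a linear
    graph leads only to larger vertices or back to 1, so a simple 1-cycle is an
    increasing sequence of vertices followed by a return to 1, and any cycle
    runs through 1.

    The hypothesis concerns some vertex u and is first carried to the vertex 1:
    if r is the radius of convergence R_u, then the sum of the q(l) r^l is at
    most 1, and for any z > r infinitely many terms q(l) z^l exceed 1
    ([critical_radius]).  They are obtained from positive functions y
    with z A y <= y away from a target vertex: such a function dominates the
    generating functions of first hitting weights, and these generating
    functions themselves provide candidates ([retsum_le1_home],
    [retsum_bounded_beyond]).

    Let H = G_{n,m} have Perron eigenvalue 1/z, so that z is the point where
    the return generating function of H equals 1.  With eigenvectors normalized
    to be 1 at the vertex 1, the equilibrium measure of H gives the event
    omega_0 = 1 the probability 1/T, where T is the mean length of an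
    excursion from 1, for cycles chosen with probability weight times z^length.
    Fix n.  The edges of H that return to 1 leave from vertices of two kinds:
    vertices reached from 1 in at most n steps, which are bounded by some M that
    depends on n only, and vertices not smaller than m.  The vertices
    reached in at most L steps are bounded as well; so once m is large enough
    with respect to L, no simple cycle of H has its length between M and L
    ([ret_Gnm_gap]).  The cycles of H of length at most M have total probability
    at most the sum of the q(l) z^l over l <= M.  Since q(m) z^m <= 1 (H contains
    all simple cycles of length m), taking m among the indices where q(m) is
    large forces z close to r, and that sum stays below 1 - eps for an
    eps > 0 that depends on n only.  Hence excursions longer than L have
    probability at least eps and T >= L eps ([survival], [total_mass_ge]), which
    exceeds n if L was chosen large ([Gnm_equilibrium]).  The probability of
    omega_0 = w is at most a constant, depending on w only, times that of
    omega_0 = 1, because of the cycle 1, 2, ..., w, 1 ([chain_weight_le]).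
    Iterating the choice of m from n gives the sequence.

    The equilibrium measures themselves are constructed: a stationary Markov
    chain on a finite alphabet is realized on [0, 1[ with Lebesgue measure by
    nested subdivisions into intervals whose lengths are the prescribed
    probabilities of words ([markov_measure], [markov_measure_cylinder]). *)

Local Open Scope classical_set_scope.
Local Open Scope ring_scope.

(** * First-passage generating functions *)

Section FirstPassage.
Variables (R : realType) (A : nat -> nat -> R) (D : nat -> nat).
Hypothesis A_ge0 : forall x y, 0 <= A x y.

(** The action of the matrix A on functions.  The sum is finite because D bounds
    the out-neighbours of each vertex. *)
Definition step (f : nat -> R) (w : nat) : R := \sum_(y < D w) A w y * f y.

(** Total weight of the paths of n steps from w that meet u only at their end. *)
Fixpoint hit (u n w : nat) : R :=
  if n is n'.+1 then (if w == u then 0 else step (hit u n') w) else (w == u)%:R.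

(** Total weight of the simple u-cycles of length n + 1: the index is shifted by
    one since a cycle has at least one edge. *)
Definition ret (u n : nat) : R := step (hit u n) u.

Definition hitsum (u : nat) (z : R) (N w : nat) : R :=
  \sum_(n < N) hit u n w * z ^+ n.

Definition retsum (u : nat) (z : R) (N : nat) : R :=
  \sum_(n < N) ret u n * z ^+ n.+1.

Lemma step_scale f c w : step (fun y => f y * c) w = step f w * c.
Proof. by rewrite mulr_suml; apply: eq_bigr => y _; rewrite mulrA. Qed.

Lemma stepB f g w : step (fun y => f y - g y) w = step f w - step g w.
Proof. by rewrite -sumrB; apply: eq_bigr => y _; rewrite mulrBr. Qed.

Lemma step_row0 f w : (forall y, A w y = 0) -> step f w = 0.
Proof. by move=> A0; apply: big1 => y _; rewrite A0 mul0r. Qed.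

Lemma step_le f g w : (forall y, f y <= g y) -> step f w <= step g w.
Proof. by move=> fg; apply: ler_sum => y _; rewrite ler_wpM2l. Qed.

Lemma step_ge0 f w : (forall y, 0 <= f y) -> 0 <= step f w.
Proof. by move=> f0; apply: sumr_ge0 => y _; rewrite mulr_ge0. Qed.

Lemma le_step1 f w y : (forall y, 0 <= f y) -> (y < D w)%N ->
  A w y * f y <= step f w.
Proof.
move=> f0 yD; rewrite /step (bigD1 (Ordinal yD)) //= lerDl.
by apply: sumr_ge0 => x _; rewrite mulr_ge0.
Qed.

Lemma hit_ge0 u n w : 0 <= hit u n w.
Proof.
elim: n w => [|n IH] w /=; first exact: ler0n.
by case: ifP => // _; exact: step_ge0.
Qed.

Lemma ret_ge0 u n : 0 <= ret u n.
Proof. by apply: step_ge0 => y; exact: hit_ge0. Qed.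

Lemma step_hitsum u z N w :
  z * step (hitsum u z N) w = \sum_(n < N) step (hit u n) w * z ^+ n.+1.
Proof.
rewrite /step /hitsum mulr_sumr.
under eq_bigr do rewrite !mulr_sumr.
rewrite exchange_big /=; apply: eq_bigr => n _.
by rewrite mulr_suml; apply: eq_bigr => y _; rewrite exprS; ring.
Qed.

Lemma retsum0 u z : retsum u z 0 = 0.
Proof. exact: big_ord0. Qed.

Lemma retsumS u z N : retsum u z N.+1 = retsum u z N + ret u N * z ^+ N.+1.
Proof. exact: big_ord_recr. Qed.

Lemma retsumE u z N : retsum u z N = z * step (hitsum u z N) u.
Proof. by rewrite step_hitsum. Qed.

Lemma hitsum_target u z N : hitsum u z N.+1 u = 1.
Proof.
rewrite /hitsum big_ord_recl /= eqxx mulr1 big1 ?addr0 // => n _.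
by rewrite mul0r.
Qed.

(** First-step decomposition: away from the target, truncated hitting series
    satisfy the eigenvalue equation, up to a shift of the truncation order. *)
Lemma hitsumS u z N w : w != u ->
  hitsum u z N.+1 w = z * step (hitsum u z N) w.
Proof.
move=> /negPf wu; rewrite step_hitsum /hitsum big_ord_recl /= wu mul0r add0r.
by apply: eq_bigr => n _.
Qed.

Lemma hitsum_ge0 u z N w : 0 <= z -> 0 <= hitsum u z N w.
Proof.
by move=> z0; apply: sumr_ge0 => n _; rewrite mulr_ge0 ?hit_ge0 ?exprn_ge0.
Qed.

Lemma hitsum_leS u z N w : 0 <= z -> hitsum u z N w <= hitsum u z N.+1 w.
Proof.
by move=> z0; rewrite /hitsum big_ord_recr /= lerDl mulr_ge0 ?hit_ge0 ?exprn_ge0.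
Qed.

Lemma hitsum_mono u z w : 0 <= z -> nondecreasing_seq (fun N => hitsum u z N w).
Proof. by move=> z0; apply/nondecreasing_seqP => N; exact: hitsum_leS. Qed.

Lemma hitsum_mono_z u z z' N w : 0 <= z -> z <= z' ->
  hitsum u z N w <= hitsum u z' N w.
Proof.
move=> z0 zz'; apply: ler_sum => n _; rewrite ler_wpM2l ?hit_ge0 //.
by rewrite lerXn2r // nnegrE (le_trans z0).
Qed.

Lemma retsum_mono u z M N : 0 <= z -> (M <= N)%N -> retsum u z M <= retsum u z N.
Proof.
move=> z0 MN; apply: (@homo_leq _ _ <=%R (@lexx _ _) (@le_trans _ _)) MN => n.
by rewrite /retsum big_ord_recr /= lerDl mulr_ge0 ?ret_ge0 ?exprn_ge0.
Qed.

Lemma retsum_ge0 u z N : 0 <= z -> 0 <= retsum u z N.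
Proof.
by move=> z0; apply: sumr_ge0 => n _; rewrite mulr_ge0 ?ret_ge0 ?exprn_ge0.
Qed.

Lemma retsum_mono_z u z z' N : 0 <= z -> z <= z' -> retsum u z N <= retsum u z' N.
Proof.
move=> z0 zz'; apply: ler_sum => n _; rewrite ler_wpM2l ?ret_ge0 //.
by rewrite lerXn2r // nnegrE (le_trans z0).
Qed.

Lemma retsum_ge_term u z N t : 0 <= z -> (t < N)%N ->
  ret u t * z ^+ t.+1 <= retsum u z N.
Proof.
move=> z0 tN; rewrite /retsum (bigD1 (Ordinal tN)) //= lerDl.
by apply: sumr_ge0 => i _; rewrite mulr_ge0 ?ret_ge0 ?exprn_ge0.
Qed.

Lemma retsum_lt u z z' N : 0 < ret u 0 -> 0 <= z -> z < z' ->
  retsum u z N.+1 < retsum u z' N.+1.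
Proof.
move=> r0 z0 zz'; rewrite /retsum !big_ord_recl ltr_leD //.
  by rewrite !expr1 ltr_pM2l.
apply: ler_sum => i _; rewrite ler_wpM2l ?ret_ge0 // lerXn2r ?nnegrE ?(ltW zz') //.
exact: le_trans (ltW zz').
Qed.

(** Minimality: the hitting series is the smallest positive function that is
    superharmonic away from the target and at least 1 there.  Nothing is asked
    at the target, which is what makes [retsum_le_super] a criterion for the
    convergence of the return series. *)
Lemma hitsum_le_super u z y N w : 0 <= z -> (forall w, 0 <= y w) -> 1 <= y u ->
  (forall w, w != u -> z * step y w <= y w) -> hitsum u z N w <= y w.
Proof.
move=> z0 y0 yu ysup; elim: N w => [|N IH] w; first by rewrite /hitsum big_ord0.
have [->|wu] := eqVneq w u; first by rewrite hitsum_target.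
rewrite hitsumS //; apply: le_trans (ysup _ wu).
by rewrite ler_wpM2l // step_le.
Qed.

Lemma retsum_le_super u z y N : 0 <= z -> (forall w, 0 <= y w) -> 1 <= y u ->
  (forall w, w != u -> z * step y w <= y w) -> retsum u z N <= z * step y u.
Proof.
move=> z0 y0 yu ysup; rewrite retsumE ler_wpM2l // step_le // => w.
exact: hitsum_le_super.
Qed.

(** The chord bound replaces continuity arguments: it controls the return series
    just to the right of a point, uniformly in the truncation. *)
Lemma exprn_convex (a b t : R) n : 0 <= a -> a <= b -> 0 <= t <= 1 ->
  (a + t * (b - a)) ^+ n <= a ^+ n + t * (b ^+ n - a ^+ n).
Proof.
move=> a0 ab /andP[t0 t1]; have b0 := le_trans a0 ab.
have c0 : 0 <= a + t * (b - a) by rewrite addr_ge0 // mulr_ge0 // subr_ge0.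
elim: n => [|n IH]; first by rewrite !expr0; lra.
rewrite exprS; apply: le_trans (ler_wpM2l c0 IH) _.
have abn : a ^+ n <= b ^+ n by rewrite lerXn2r.
rewrite -subr_ge0 !exprS.
have -> : a * a ^+ n + t * (b * b ^+ n - a * a ^+ n) -
  (a + t * (b - a)) * (a ^+ n + t * (b ^+ n - a ^+ n)) =
  t * (1 - t) * ((b - a) * (b ^+ n - a ^+ n)) by ring.
by rewrite !mulr_ge0 // subr_ge0.
Qed.

Lemma retsum_convex u (a b t : R) N : 0 <= a -> a <= b -> 0 <= t <= 1 ->
  retsum u (a + t * (b - a)) N <=
  retsum u a N + t * (retsum u b N - retsum u a N).
Proof.
move=> a0 ab t01.
rewrite /retsum -sumrB mulr_sumr -big_split /=; apply: ler_sum => n _.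
rewrite -mulrBr mulrCA -mulrDr ler_wpM2l ?ret_ge0 //.
exact: exprn_convex.
Qed.

Section Limit.
Variables (u : nat) (z : R).
Hypothesis z_ge0 : 0 <= z.
Hypothesis bnd : forall w, exists B, forall N, hitsum u z N w <= B.

(** The generating function of the hitting weights at z. *)
Definition hitlim w : R := limn (fun N => hitsum u z N w).

Lemma hitsum_cvg w : hitsum u z N w @[N --> \oo] --> hitlim w.
Proof.
have [B HB] := bnd w.
apply: (@nondecreasing_is_cvgn _ (fun N => hitsum u z N w)).
  exact: hitsum_mono.
by exists B => _ [N _ <-].
Qed.

Lemma hitsum_le_lim N w : hitsum u z N w <= hitlim w.
Proof.
apply: (@nondecreasing_cvgn_le _ (fun N => hitsum u z N w)).
  exact: hitsum_mono.
exact: (cvgP _ (@hitsum_cvg w)).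
Qed.

Lemma hitlim_ge0 w : 0 <= hitlim w.
Proof. by apply: le_trans (hitsum_le_lim 0 w); rewrite hitsum_ge0. Qed.

Lemma hitlim_target : hitlim u = 1.
Proof.
apply/cvg_lim => //; rewrite -cvg_shiftS /=.
under eq_fun do rewrite hitsum_target.
exact: cvg_cst.
Qed.

Lemma step_hitlim_cvg w :
  z * step (hitsum u z N) w @[N --> \oo] --> z * step hitlim w.
Proof.
apply: cvgM; first exact: cvg_cst.
rewrite /step; elim: (index_enum _) => [|y s IH].
  by under eq_fun do rewrite big_nil; rewrite big_nil; exact: cvg_cst.
under eq_fun do rewrite big_cons; rewrite big_cons.
by apply: cvgD => //; apply: cvgM; [exact: cvg_cst|exact: hitsum_cvg].
Qed.

Lemma hitlim_harmonic w : w != u -> z * step hitlim w = hitlim w.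
Proof.
move=> wu; apply/esym/cvg_lim => //; rewrite -cvg_shiftS /=.
under eq_fun do rewrite hitsumS //.
exact: step_hitlim_cvg.
Qed.

Lemma step_hitlim_le C : (forall N, retsum u z N <= C) -> z * step hitlim u <= C.
Proof.
move=> H; rewrite -(cvg_lim _ (@step_hitlim_cvg u)) //.
apply: limr_le; first exact: (cvgP _ (@step_hitlim_cvg u)).
by apply: nearW => N; rewrite -retsumE.
Qed.

End Limit.
End FirstPassage.

(** * The critical radius at the home vertex *)

Section Transfer.
Variables (R : realType) (A : nat -> nat -> R) (D : nat -> nat).
Hypothesis A_ge0 : forall x y, 0 <= A x y.
Hypothesis A_D : forall x y, 0 < A x y -> (y < D x)%N.
Hypothesis A_next : forall w, (0 < w)%N -> 0 < A w w.+1.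
Hypothesis A_home : forall w, (0 < w)%N -> 0 < A w 1.
Hypothesis A_0l : forall y, A 0 y = 0.

Local Notation step := (step A D).
Local Notation hitsum := (hitsum A D).
Local Notation retsum := (retsum A D).
Local Notation ret := (ret A D).

Lemma step_edge f w y : (forall x, 0 <= f x) -> 0 < A w y -> A w y * f y <= step f w.
Proof. by move=> f0 /A_D; exact: le_step1. Qed.

(** Boundedness propagates along edges, since z A(w,y) times the series at y is
    a part of the series at w; it starts at u, through the return series, and the
    edges u -> 1 -> 2 -> 3 -> ... lead to all vertices. *)
Lemma hitsum_bounded u z C : (0 < u)%N -> 0 < z ->
  (forall N, retsum u z N <= C) -> forall w, exists B, forall N, hitsum u z N w <= B.
Proof.
move=> u0 z0 HC; have z00 := ltW z0.
pose bounded w := exists B, forall N, z * step (hitsum u z N) w <= B.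
have bdu : bounded u by exists C => N; rewrite -retsumE.
have bd_edge w y : 0 < A w y -> bounded w -> bounded y.
  move=> Awy [B HB]; have [->//|yu] := eqVneq y u.
  exists (B / (z * A w y)) => N; rewrite -hitsumS //.
  rewrite ler_pdivlMr ?mulr_gt0 //; apply: le_trans (HB N.+1).
  rewrite mulrC -mulrA ler_wpM2l //.
  by apply: step_edge => // x; exact: hitsum_ge0.
have bd w : (0 < w)%N -> bounded w.
  elim: w => // -[|w] IH _; first exact: bd_edge (A_home u0) bdu.
  by apply: bd_edge (IH _) => //; exact: A_next.
move=> w; have [->|wu] := eqVneq w u.
  exists 1 => N; apply: le_trans (hitsum_leS D A_ge0 u N u z00) _.
  by rewrite hitsum_target.
have [w0|w0] := posnP w.
  exists 0 => N; apply: le_trans (hitsum_leS D A_ge0 u N w z00) _.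
  by rewrite hitsumS // w0 step_row0 // mulr0.
have [B HB] := bd w w0; exists B => N.
by apply: le_trans (hitsum_leS D A_ge0 u N w z00) _; rewrite hitsumS.
Qed.

(** If the return series of u is at most 1 at r, then the hitting generating
    function x of u satisfies r A x <= x at all vertices, u included; the same x,
    divided by its value at 1, bounds the return series of 1. *)
Lemma retsum_le1_home u r : (0 < u)%N -> 0 < r ->
  (forall N, retsum u r N <= 1) -> forall N, retsum 1 r N <= 1.
Proof.
move=> u0 r0 Hu; have r00 := ltW r0; have [u1|u1] := eqVneq u 1%N.
  by rewrite -u1.
have bnd := hitsum_bounded u0 r0 Hu.
pose x := hitlim A D u r.
have x0 w : 0 <= x w by exact: hitlim_ge0.
have xu : x u = 1 by exact: hitlim_target.
have xsup w : r * step x w <= x w.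
  have [->|wu] := eqVneq w u; first by rewrite xu; exact: step_hitlim_le.
  by rewrite [leRHS](esym (hitlim_harmonic A_ge0 r00 bnd wu)).
have xpos d : forall w, (0 < w)%N -> (w + d)%N = u -> 0 < x w.
  elim: d => [|d IH] w w0; first by rewrite addn0 => ->; rewrite xu.
  rewrite addnS -addSn => /IH - /(_ isT) xw; apply: lt_le_trans (xsup w).
  rewrite mulr_gt0 //; apply: lt_le_trans (step_edge x0 (A_next w0)).
  by rewrite mulr_gt0 // A_next.
have x1 : 0 < x 1%N by apply: (xpos u.-1) => //; rewrite add1n prednK.
move=> N; pose y w := x w / x 1%N.
have stepy w : r * step y w <= y w.
  by rewrite /y step_scale mulrA ler_pM2r ?invr_gt0.
have y1 : y 1%N = 1 by rewrite /y divff ?gt_eqF.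
rewrite -[leRHS]y1; apply: le_trans (stepy 1%N).
by apply: retsum_le_super => //; [move=> w; rewrite divr_ge0|rewrite y1].
Qed.

(** If the return series of 1 converges beyond r, so does that of u.  Slightly
    beyond r, the hitting generating function F of 1 is harmonic except at 1,
    where z' A F may exceed F by a small amount.  Subtracting from F a function
    eta supported on the chain 2, ..., u lowers z' A F at 1 by a fixed amount and
    keeps the inequality z' A y <= y at all vertices but u, where it is not
    required; this gives a function y to which [retsum_le_super] applies. *)
Lemma retsum_bounded_beyond u r z C : (1 < u)%N -> 0 < r -> r < z ->
  (forall N, retsum 1 r N <= 1) -> (forall N, retsum 1 z N <= C) ->
  exists z', r < z' /\ exists C', forall N, retsum u z' N <= C'.
Proof.
move=> u1 r0 rz Hr Hz; have r00 := ltW r0; have u0 : (0 < u)%N by exact: ltnW.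
have C0 : 0 <= C by apply: le_trans (Hz 0%N); rewrite retsum0.
have bndr := hitsum_bounded (ltn0Sn 0) r0 Hr.
pose Fr := hitlim A D 1 r.
have Fr0 w : 0 <= Fr w by exact: hitlim_ge0.
have Fr_next w y : w != 1%N -> 0 < A w y -> r * A w y * Fr y <= Fr w.
  move=> w1 Awy; rewrite [leRHS](esym (hitlim_harmonic A_ge0 r00 bndr w1)).
  by rewrite -mulrA ler_wpM2l // step_edge.
have Fru : 0 < Fr u.
  apply: lt_le_trans (Fr_next u 1%N _ (A_home u0)); last by rewrite gtn_eqF.
  by rewrite [Fr 1%N]hitlim_target mulr1 mulr_gt0 // A_home.
(* g solves g = r A g along the chain, with half of Fr at its end u, so that it
   stays below half of Fr on 2, ..., u and F - g remains positive. *)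
pose g w := \prod_(w <= i < u) (r * A i i.+1) * (Fr u / 2).
have g_rec w : (w < u)%N -> g w = r * A w w.+1 * g w.+1.
  by move=> wu; rewrite /g big_ltn // !mulrA.
have g_gt0 w : (0 < w)%N -> 0 < g w.
  move=> w0; rewrite /g mulr_gt0 ?divr_gt0 // big_nat prodr_gt0 // => i /andP[wi _].
  by rewrite mulr_gt0 // A_next // (leq_trans w0).
have g_le d : forall w, (1 < w)%N -> (w + d)%N = u -> g w <= Fr w / 2.
  elim: d => [|d IH] w w1; first by rewrite addn0 => ->; rewrite /g big_geq // mul1r.
  move=> wd; have wu : (w < u)%N by rewrite -wd addnS ltnS leq_addr.
  rewrite g_rec //; have w0 : (0 < w)%N by exact: ltnW.
  apply: le_trans (_ : r * A w w.+1 * (Fr w.+1 / 2) <= _).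
    by rewrite ler_wpM2l ?mulr_ge0 // IH ?addSnnS // ltnW.
  by rewrite mulrA ler_pM2r // Fr_next ?gtn_eqF // A_next.
pose eta w := if (1 < w <= u)%N then g w else 0.
have eta0 w : 0 <= eta w.
  by rewrite /eta; case: ifP => // /andP[w1 _]; rewrite ltW // g_gt0 // ltnW.
(* The amount by which subtracting eta lowers z' A F at 1. *)
pose del := r * A 1 2 * g 2%N.
have del0 : 0 < del by rewrite mulr_gt0 ?g_gt0 // mulr_gt0 // A_next.
(* z' is taken so close to r that the return series of 1 is at most 1 + del. *)
pose t := del / (del + C).
have dC : 0 < del + C by rewrite ltr_wpDr.
have t0 : 0 < t by rewrite divr_gt0.
have t1 : t <= 1 by rewrite ler_pdivrMr // mul1r lerDl.
have tC : t * C <= del.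
  rewrite /t mulrAC ler_pdivrMr // mulrDr lerDr.
  by rewrite mulr_ge0 // ltW.
pose z' := r + t * (z - r).
have rz' : r < z' by rewrite ltrDl mulr_gt0 // subr_gt0.
have z'0 : 0 < z' by exact: lt_trans rz'.
have z'00 := ltW z'0.
have Hz' N : retsum 1 z' N <= 1 + del.
  apply: le_trans (retsum_convex D A_ge0 1 N r00 (ltW rz) _) _.
    by rewrite (ltW t0).
  have := Hr N; have := Hz N; set a := retsum 1 r N; set b := retsum 1 z N.
  move=> bC a1; have : t * b <= t * C by rewrite ler_wpM2l // ltW.
  have : 0 <= (1 - t) * (1 - a) by rewrite mulr_ge0 // subr_ge0.
  by lra.
have bnd := hitsum_bounded (ltn0Sn 0) z'0 Hz'.
pose F := hitlim A D 1 z'.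
have FrF w : Fr w <= F w.
  apply: limr_le; first exact: (cvgP _ (hitsum_cvg A_ge0 r00 bndr (w := w))).
  apply: nearW => N; apply: le_trans (hitsum_le_lim A_ge0 z'00 bnd N w).
  exact: hitsum_mono_z (ltW rz').
have F1 : F 1%N = 1 by exact: hitlim_target.
have stepF1 : z' * step F 1 <= 1 + del by exact: step_hitlim_le.
have stepF w : w != 1%N -> z' * step F w = F w by exact: hitlim_harmonic.
have etaF w : eta w <= F w / 2.
  rewrite /eta; case: ifP => [/andP[w1 wu]|_].
    apply: le_trans (g_le (u - w)%N w w1 _) _; first by rewrite subnKC.
    by rewrite ler_pM2r.
  by rewrite divr_ge0 // (le_trans (Fr0 w)).
have eta_edge w : r * A w w.+1 * eta w.+1 <= z' * step eta w.
  have [->|w0] := posnP w; first by rewrite A_0l -mulrA mul0r mulr0 mulr_ge0 ?step_ge0.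
  apply: le_trans (_ : r * step eta w <= _).
    by rewrite -mulrA ler_wpM2l // step_edge // A_next.
  by rewrite ler_wpM2r ?step_ge0 // ltW.
pose y w := F w - eta w.
have y0 w : 0 <= y w.
  by have := etaF w; have := le_trans (Fr0 w) (FrF w); rewrite /y; lra.
have yu : 0 < y u.
  by have := etaF u; have := lt_le_trans Fru (FrF u); rewrite /y; lra.
have stepyE w : step y w = step F w - step eta w.
  exact: stepB.
have ysup w : w != u -> z' * step y w <= y w.
  move=> wu; rewrite stepyE mulrBr; have [w1|w1] := eqVneq w 1%N.
    have := eta_edge w; rewrite /y w1 F1 /eta /= u1 -/del; move: stepF1; lra.
  rewrite stepF // /y lerB // {1}/eta; case: ifP => [/andP[w1' wu']|_].
    have {}wu : (w < u)%N by rewrite ltn_neqAle wu.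
    apply: le_trans (eta_edge w).
    by rewrite g_rec // /eta wu ltnW.
  by rewrite mulr_ge0 ?step_ge0.
exists z'; split => //; exists (z' * step (fun w => y w / y u) u) => N.
apply: retsum_le_super => // [w||w wu].
- by rewrite divr_ge0 // ltW.
- by rewrite divff ?gt_eqF.
- by rewrite step_scale mulrA ler_pM2r ?invr_gt0 // ysup.
Qed.

Lemma retsum_unbounded_home u r : (0 < u)%N -> 0 < r ->
  (forall N, retsum u r N <= 1) ->
  (forall z C, r < z -> exists N, C < retsum u z N) ->
  forall z C, r < z -> exists N, C < retsum 1 z N.
Proof.
move=> u0 r0 Hr Hz z C rz; have [u1|u1] := eqVneq u 1%N.
  by rewrite -u1; exact: Hz.
apply: contrapT => noN.
have {}u1 : (1 < u)%N by rewrite ltn_neqAle eq_sym u1.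
have HC N : retsum 1 z N <= C by rewrite leNgt; apply/negP => ?; apply: noN; exists N.
have [z' [rz' [C' HC']]] :=
  retsum_bounded_beyond u1 r0 rz (retsum_le1_home u0 r0 Hr) HC.
by have [N] := Hz z' C' rz'; rewrite ltNge HC'.
Qed.

(** If the terms were at most 1 from some index on at a point z > r, then at the
    midpoint of r and z the series would be dominated by a geometric one. *)
Lemma ret_large u r : 0 < r ->
  (forall z C, r < z -> exists N, C < retsum u z N) ->
  forall z m0, r < z -> exists2 m, (m0 <= m)%N & 1 < ret u m * z ^+ m.+1.
Proof.
move=> r0 Hz z m0 rz; apply: contrapT => nom.
have small m : (m0 <= m)%N -> ret u m * z ^+ m.+1 <= 1.
  by move=> mm; rewrite leNgt; apply/negP => ?; apply: nom; exists m.
pose z1 := (r + z) / 2; pose q := z1 / z.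
have z0 : 0 < z by exact: lt_trans rz.
have rz1 : r < z1 by rewrite /z1; lra.
have z10 : 0 <= z1 by rewrite ltW // (lt_trans r0).
have q0 : 0 <= q by rewrite divr_ge0 // ltW.
have q1 : q < 1 by rewrite ltr_pdivrMr // mul1r /z1; lra.
have {Hz}[N] := Hz z1 (retsum u z1 m0 + 1 / (1 - q)) rz1.
apply/negP; rewrite -leNgt.
apply: le_trans (retsum_mono D A_ge0 u z10 (leq_addl m0 N)) _.
suff H : retsum u z1 (m0 + N) <= retsum u z1 m0 + (1 - q ^+ N) / (1 - q).
  apply: le_trans H _; rewrite lerD2l ler_pM2r ?invr_gt0 ?subr_gt0 //.
  by rewrite lerBlDr lerDl exprn_ge0.
elim: N => [|N IH]; first by rewrite addn0 expr0 subrr mul0r addr0.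
rewrite addnS retsumS.
have step1 : ret u (m0 + N) * z1 ^+ (m0 + N).+1 <= q ^+ N.
  have -> : z1 = z * q by rewrite /q mulrC divfK ?gt_eqF.
  rewrite exprMn mulrA; apply: le_trans (_ : q ^+ (m0 + N).+1 <= _).
    by rewrite ler_piMl ?exprn_ge0 // small // leq_addr.
  by apply: ler_wiXn2l; [|exact: ltW|exact: leqW (leq_addl _ _)].
apply: le_trans (lerD IH step1) _.
rewrite -addrA lerD2l exprS; have q1' : 1 - q != 0 by rewrite subr_eq0 gt_eqF.
by rewrite le_eqVlt; apply/orP; left; apply/eqP; field.
Qed.

End Transfer.

(** * Simple cycles and first-passage weights *)

Section CycleLists.
Variables (R : realType) (K : digraph) (W : nat * nat -> R) (D : nat -> nat).
Hypothesis K_D : forall x y, eset K (x, y) -> (y < D x)%N.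
Hypothesis W_gt0 : forall e, eset K e -> 0 < W e.

Lemma adj_ge0 x y : 0 <= adj K W x y.
Proof.
by rewrite /adj; case: ifP => // /set_mem /W_gt0 /ltW.
Qed.

Lemma adj_gt0 x y : 0 < adj K W x y <-> eset K (x, y).
Proof.
rewrite /adj; split => [|Kxy]; last by rewrite mem_set // W_gt0.
by case: ifP => [/set_mem //|]; rewrite ltxx.
Qed.

(** Explicit finite lists of the first-passage paths, following the recursion of
    [hit]; a path is listed without its starting point. *)
Definition extensions (h : nat -> seq (seq nat)) (w : nat) : seq (seq nat) :=
  [seq y :: s | y <- [seq y <- index_iota 0 (D w) | (w, y) \in eset K], s <- h y].

Fixpoint hitting_paths (u n w : nat) : seq (seq nat) :=
  if n is n'.+1 then
    if w == u then [::] else extensions (hitting_paths u n') w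
  else if w == u then [:: [::]] else [::].

Lemma path_edges_cons w y s : path_edges (w, y :: s) = (w, y) :: path_edges (y, s).
Proof. by []. Qed.

Lemma path_weight_cons w y s :
  path_weight W (w, y :: s) = W (w, y) * path_weight W (y, s).
Proof. by rewrite /path_weight path_edges_cons big_cons. Qed.

Lemma sum_extensions h w :
  \sum_(s <- extensions h w) path_weight W (w, s) =
  step (adj K W) D (fun y => \sum_(s <- h y) path_weight W (y, s)) w.
Proof.
rewrite /step big_allpairs_dep big_filter big_mkcond /=.
rewrite big_mkord; apply: eq_bigr => y _.
rewrite /adj; case: ifP => _; last by rewrite mul0r.
by rewrite mulr_sumr; apply: eq_bigr => s _; rewrite path_weight_cons.
Qed.

Lemma sum_hitting_paths u n w :
  \sum_(s <- hitting_paths u n w) path_weight W (w, s) = hit (adj K W) D u n w.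
Proof.
elim: n w => [|n IH] w /=; case: ifP => _; rewrite ?big_nil //.
  by rewrite big_seq1 /path_weight /path_edges /= big_nil.
by rewrite sum_extensions; apply: eq_bigr => y _; rewrite IH.
Qed.

Lemma extensions_uniq h w : (forall y, uniq (h y)) -> uniq (extensions h w).
Proof.
move=> hu; apply: allpairs_uniq_dep => //; first by rewrite filter_uniq // iota_uniq.
by move=> [y s] [y' s'] _ _ /= [-> ->].
Qed.

Lemma hitting_paths_uniq u n w : uniq (hitting_paths u n w).
Proof.
by elim: n w => [|n IH] w /=; case: ifP => // _; exact: extensions_uniq.
Qed.

Lemma mem_extensions h w s : reflect
  (exists y t, [/\ s = y :: t, eset K (w, y) & t \in h y]) (s \in extensions h w).
Proof.
apply: (iffP allpairsPdep) => [[y [t [+ th ->]]]|[y [t [-> wy th]]]].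
  by rewrite mem_filter => /andP[/set_mem wy _]; exists y, t.
exists y, t; split => //; rewrite mem_filter mem_index_iota K_D // andbT.
by rewrite /= mem_set.
Qed.

Definition first_hit (u w : nat) (s : seq nat) : Prop :=
  [/\ forall e, e \in path_edges (w, s) -> eset K e, last w s = u &
      forall i, (i < size s)%N -> nth 0%N (w :: s) i <> u].

Lemma mem_hitting_paths u n w s :
  s \in hitting_paths u n w <-> first_hit u w s /\ size s = n.
Proof.
elim: n w s => [|n IH] w s /=.
  have [->|wu] := eqVneq w u.
    rewrite mem_seq1; split => [/eqP ->|[_ /eqP]]; first by [].
    by rewrite size_eq0.
  split => // -[[_ + _] /eqP]; rewrite size_eq0 => /[swap] /eqP -> /= /eqP.
  by rewrite (negPf wu).
have [->|wu] := eqVneq w u.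
  by split => // -[[_ _ /(_ 0%N) H] sn]; case: H; rewrite ?sn.
split => [/mem_extensions[y [t [-> wy /IH[[te tl ti] tn]]]]|].
  split; last by rewrite /= tn.
  split => // [e|[|i] //=]; last exact: ti.
  - by rewrite path_edges_cons inE => /predU1P[-> //|/te].
  - by move=> _; exact/eqP.
case; case: s => // y t [te tl ti] [tn]; apply/mem_extensions; exists y, t.
split => //; first by apply: te; rewrite path_edges_cons mem_head.
apply/IH; split => //; split => // [e et|i it].
  by apply: te; rewrite path_edges_cons inE et orbT.
exact: (ti i.+1).
Qed.

Lemma mem_simple_cycles u n g :
  simple_cycles K u n.+1 g <->
  exists2 s, s \in extensions (hitting_paths u n) u & g = (u, s).
Proof.
split => [[[[gu gl _ ge] gi] gn]|[s /mem_extensions[y [t [-> uy]]]]].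
  case: g gu gl ge gi gn => _ [//|y t] /= -> tl te ti [tn]; exists (y :: t) => //.
  apply/mem_extensions; exists y, t; split => //.
    by apply: te; rewrite path_edges_cons mem_head.
  apply/mem_hitting_paths; split => //; split => // [e et|i it].
    by apply: te; rewrite path_edges_cons inE et orbT.
  exact: (ti i.+1).
move=> /mem_hitting_paths[[te tl ti] tn] ->; split; last by rewrite /path_length /= tn.
split => [|[//|i]]; last by exact: ti.
by split => // e; rewrite path_edges_cons inE => /predU1P[-> //|/te].
Qed.

(** The sum over the set of simple cycles is a finite sum, evaluated by the
    first-step recursion. *)
Lemma q_ret u n : q_ K W u n.+1 = (ret (adj K W) D u n)%:E.
Proof.
pose L := [seq (u, s) | s <- extensions (hitting_paths u n) u].
have LE : simple_cycles K u n.+1 = [set` L].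
  apply/seteqP; split => g /=.
    by move=> /mem_simple_cycles[s sL ->]; apply: map_f.
  by move=> /mapP[s sL ->]; apply/mem_simple_cycles; exists s.
have Lu : uniq L.
  rewrite map_inj_uniq; last by move=> s t [].
  by apply: extensions_uniq => y; exact: hitting_paths_uniq.
rewrite /q_ LE esum_fset; first last; [|exact: finite_seq|].
  move=> g; rewrite inE -LE => -[[[_ _ _ ge] _] _].
  by rewrite lee_fin /path_weight big_seq prodr_ge0 // => e /ge /W_gt0 /ltW.
rewrite -fsbig_seq // sumEFin big_map sum_extensions; congr EFin.
by apply: eq_bigr => y _; rewrite sum_hitting_paths.
Qed.

Lemma Phi_term_ge0 u z n : 0 <= z -> (1 <= n)%N ->
  (0 <= q_ K W u n * (z ^+ n)%:E)%E.
Proof.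
move=> z0; case: n => // n _; rewrite q_ret -EFinM lee_fin.
by rewrite mulr_ge0 ?exprn_ge0 // ret_ge0 // => x y; exact: adj_ge0.
Qed.

Lemma Phi_partial u z N :
  (\sum_(1 <= n < N.+1) q_ K W u n * (z ^+ n)%:E)%E =
  (retsum (adj K W) D u z N)%:E.
Proof.
rewrite big_add1 /= big_mkord /retsum -sumEFin; apply: eq_bigr => n _.
by rewrite q_ret EFinM.
Qed.

Lemma retsum_le_Phi u z N : 0 <= z ->
  ((retsum (adj K W) D u z N)%:E <= Phi K W u z)%E.
Proof.
move=> z0; rewrite -Phi_partial; apply: nneseries_lim_ge => n n1 _.
exact: Phi_term_ge0.
Qed.

Lemma Phi_le u z C : 0 <= z -> (forall N, retsum (adj K W) D u z N <= C) ->
  (Phi K W u z <= C%:E)%E.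
Proof.
move=> z0 HC; apply: lime_le.
  by apply: is_cvg_nneseries => n n1 _; exact: Phi_term_ge0.
exists 1%N => // -[//|N] _ /=; rewrite Phi_partial lee_fin.
exact: HC.
Qed.

End CycleLists.

(** * Paths and simple cycles *)

Lemma path_edgesP g e : reflect
  (exists2 i, (i < path_length g)%N &
     e = (nth 0%N (visited g) i, nth 0%N (visited g) i.+1))
  (e \in path_edges g).
Proof.
case: g => w s; rewrite /path_edges /visited /path_length /=.
have sz : size (zip (w :: s) s) = size s by rewrite size_zip /=; lia.
apply: (iffP (nthP (0, 0)%N)); rewrite sz => -[i il].
  by rewrite nth_zip_cond sz il => <-; exists i.
by move=> ->; exists i => //; rewrite nth_zip_cond sz il.
Qed.

Definition edge_rel (K : digraph) : rel nat := fun x y => (x, y) \in eset K.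

Lemma path_edges_path K w s :
  (forall e, e \in path_edges (w, s) -> eset K e) <-> path (edge_rel K) w s.
Proof.
elim: s w => [|y s IH] w; first by split=> // _ e; rewrite /path_edges.
rewrite path_edges_cons /=; split=> [H|/andP[/set_mem wy /IH H] e].
  apply/andP; split; first by apply/mem_set/H; rewrite mem_head.
  by apply/IH => e es; apply: H; rewrite inE es orbT.
by rewrite inE => /predU1P[->//|/H].
Qed.

Lemma is_path_relP K u w :
  (exists g, is_path K u w g) <->
  exists y s, path (edge_rel K) u (y :: s) /\ last y s = w.
Proof.
split=> [[[a [|y s]] [/= -> sw // _ /path_edges_path]]|[y [s [/path_edges_path ps sw]]]].
  by exists y, s.
by exists (u, y :: s).
Qed.

Lemma is_path_trans K u v w :
  (exists g, is_path K u v g) -> (exists g, is_path K v w g) ->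
  exists g, is_path K u w g.
Proof.
move=> /is_path_relP[y [s [ps sv]]] /is_path_relP[x [t [pt tw]]].
apply/is_path_relP; exists y, (s ++ x :: t); split; last by rewrite last_cat.
by rewrite -cat_cons cat_path ps [last _ _]sv.
Qed.

Lemma simple_cycle_rcons K u t :
  path (edge_rel K) u (rcons t u) -> u \notin t ->
  simple_cycles K u (size t).+1 (u, rcons t u).
Proof.
move=> pt ut; split; last by rewrite /path_length size_rcons.
split; first split => //=; rewrite ?last_rcons ?/path_length ?size_rcons //=.
  exact/path_edges_path.
case=> // i /andP[_]; rewrite ltnS => it; rewrite /visited /= nth_rcons it => iu.
by move/negP: ut; apply; rewrite -iu mem_nth.
Qed.

(** The final vertex of a cycle is also its initial one, so an index strictly
    below the length can be used. *)
Lemma visited_cycle K u l g x : simple_cycles K u l g -> x \in visited g ->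
  exists2 i, (i < l)%N & x = nth 0%N (visited g) i.
Proof.
case: g => v s [[[/= vu sl s0 _] _] <-] /(nthP 0%N)[i il <-].
rewrite /path_length /= in s0 il *; rewrite /visited /=.
move: il; rewrite ltnS leq_eqVlt => /predU1P[->|il]; last by exists i.
exists 0%N => //=.
by rewrite vu -[in RHS]sl; case: (s) s0 => // y t _; rewrite /= nth_last.
Qed.

(** A cycle is cut at the vertex x into a path to x and a path from x. *)
Lemma cycle_connects K u l g x : simple_cycles K u l g ->  x \in visited g ->
  (exists g, is_path K u x g) /\ (exists g, is_path K x u g).
Proof.
move=> cg /(visited_cycle cg)[i il ->]; case: cg => -[pg _]; move: il.
case: g pg => v s /= pg il sl; rewrite -sl in il => {l sl}.
rewrite /path_length /= in il.
have [/= vu sl _ /path_edges_path pth] := pg; rewrite vu /visited /= {v vu} in pg pth sl *.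
have [->|i0] := posnP i; first by split; exists (u, s).
have tk : take i s = rcons (take i.-1 s) (nth 0%N s i.-1).
  by rewrite -take_nth ?prednK //; lia.
have nthE : nth 0%N (u :: s) i = nth 0%N s i.-1 by case: (i) i0.
rewrite nthE; move: pth sl; rewrite -(cat_take_drop i s) cat_path last_cat.
rewrite cat_take_drop tk last_rcons => /andP[p1 p2] sl; split; apply/is_path_relP.
  case: (take i.-1 s) p1 => [|y t] /= p1.
    by exists (nth 0%N s i.-1), [::].
  by exists y, (rcons t (nth 0%N s i.-1)); rewrite last_rcons.
move: p2 sl; case dE : (drop i s) => [|y t].
  by move/(congr1 size): dE; rewrite size_drop /=; lia.
by move=> p2 sl; exists y, t.
Qed.

(** * Linear graphs and the subgraphs G_{n,m} *)

(** The shape of a linear graph, with a monotone bound D on the out-neighbours of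
    each vertex. *)
Definition locally_bounded_linear (G : digraph) (D : nat -> nat) : Prop :=
  [/\ forall w, vset G w <-> (0 < w)%N,
      forall x y, eset G (x, y) -> [/\ (0 < x)%N, y = 1%N \/ (x < y)%N & (y < D x)%N],
      forall i, (0 < i)%N -> eset G (i, 1%N) /\ eset G (i, i.+1) &
      {homo D : x y / (x <= y)%N}].

Lemma finite_set_nat_bounded (S : set nat) : finite_set S ->
  exists b, forall j, S j -> (j < b)%N.
Proof.
move=> /finite_seqP[s ->]; exists (\max_(j <- s) j).+1 => j /= js.
by rewrite ltnS (leq_bigmax_seq j).
Qed.

Lemma linear_graph_bounded G : linear_graph G ->
  exists D, locally_bounded_linear G D.
Proof.
move=> [vG [E2 [E2lt E2fin eG]]].
have eGP x y : eset G (x, y) ->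
    ((0 < x)%N /\ y = 1%N) \/ ((0 < x)%N /\ y = x.+1) \/ E2 (x, y).
  by rewrite eG => -[[[i i0 [-> ->]]|[i i0 [-> ->]]]|]; [left|right; left|right; right].
have [d dP] := choice (fun i => finite_set_nat_bounded (E2fin i)).
have le_D i : (d i <= \sum_(k < i.+1) d k)%N by rewrite big_ord_recr leq_addl.
exists (fun i => i + 2 + \sum_(k < i.+1) d k)%N; split.
- by move=> w; rewrite vG.
- move=> x y /eGP[[x0 ->]|[[x0 ->]|xy]]; first by split => //; [left|lia].
    by split => //; [right|lia].
  have [x0 xy'] := E2lt _ _ xy; split => //; first by right; exact: ltnW.
  by have := dP _ _ xy; have := le_D x; lia.
- move=> i i0; rewrite eG; split; left; first by left; exists i.
  by right; exists i.
- move=> x y xy; rewrite !leq_add //.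
  by rewrite -!(big_mkord xpredT) [leqRHS](@big_cat_nat _ _ _ x.+1) //= leq_addr.
Qed.

Section Linear.
Variables (G : digraph) (D : nat -> nat).
Hypothesis linG : locally_bounded_linear G D.

Let edgeG x y : eset G (x, y) -> [/\ (0 < x)%N, y = 1%N \/ (x < y)%N & (y < D x)%N].
Proof. by case: linG => _ + _ _; apply. Qed.

Let homeG i : (0 < i)%N -> eset G (i, 1%N).
Proof. by case: linG => _ _ + _ => /[apply] -[]. Qed.

Let nextG i : (0 < i)%N -> eset G (i, i.+1).
Proof. by case: linG => _ _ + _ => /[apply] -[]. Qed.

Let D_homo : {homo D : x y / (x <= y)%N}.
Proof. by case: linG. Qed.

(** A bound on the vertices reached from 1 in i steps. *)
Definition reach (i : nat) : nat := iter i D 1.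

Lemma reachS i : (0 < reach i <= reach i.+1)%N.
Proof.
have D1 x : (0 < x)%N -> (x <= D x)%N.
  by move=> /nextG/edgeG[_ _ H]; exact: ltnW (ltnW H).
elim: i => [|i /andP[i0 i1]] /=; first by rewrite D1.
by rewrite (leq_trans i0) // D1 // (leq_trans i0).
Qed.

Lemma reach_homo : {homo reach : i j / (i <= j)%N}.
Proof.
apply: homo_leq => //; first exact: leq_trans.
by move=> i; case/andP: (reachS i).
Qed.

(** Before its return to 1, a simple cycle increases strictly. *)
Lemma cycle_vertex l g i : simple_cycles G 1 l g -> (i < l)%N ->
  (i < nth 0%N (visited g) i <= reach i)%N.
Proof.
move=> [[[g1 _ _ gE] gn] gl]; elim: i => [|i IH] il.
  by rewrite /visited /= g1.
have /andP[IH1 IH2] := IH (ltnW il).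
have /gE/edgeG[_ [y1|xy] yD] :
    (nth 0%N (visited g) i, nth 0%N (visited g) i.+1) \in path_edges g.
- by apply/path_edgesP; exists i => //; rewrite gl ltnW.
- by case: (gn i.+1 _ y1); rewrite gl.
rewrite (leq_ltn_trans IH1 xy) (leq_trans (ltnW yD)) //=; exact: D_homo.
Qed.

Lemma mem_Gnm n m e : eset (Gnm G n m) e <->
  exists g l, [/\ (l <= n)%N \/ l = m, simple_cycles G 1 l g & e \in path_edges g].
Proof.
split=> [[g [[l /= ln cg]|cg] eg]|[g [l [[ln|->] cg eg]]]].
- by exists g, l; split => //; left.
- by exists g, m; split => //; right.
- by exists g => //; left; exists l.
- by exists g => //; right.
Qed.

Lemma mem_Gnm_vset n m x : vset (Gnm G n m) x <->
  exists g l, [/\ (l <= n)%N \/ l = m, simple_cycles G 1 l g & x \in visited g].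
Proof.
split=> [[g [[l /= ln cg]|cg] eg]|[g [l [[ln|->] cg eg]]]].
- by exists g, l; split => //; left.
- by exists g, m; split => //; right.
- by exists g => //; left; exists l.
- by exists g => //; right.
Qed.

Lemma Gnm_subgraph n m : subgraph (Gnm G n m) G.
Proof.
apply: generated_subgraph_least => g [[l _]|] [[pg _] _]; by exists 1%N, 1%N.
Qed.

Lemma Gnm_cycle n m l g : (l <= n)%N \/ l = m -> simple_cycles G 1 l g ->
  simple_cycles (Gnm G n m) 1 l g.
Proof.
move=> ln cg; have [[pg gi] gl] := cg; split => //; split => //.
have [g1 g2 g3 _] := pg; split => // e eg; apply/mem_Gnm; by exists g, l.
Qed.

Lemma simple_cycles_Gnm n m l : (l <= n)%N \/ l = m ->
  simple_cycles (Gnm G n m) 1 l = simple_cycles G 1 l.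
Proof.
move=> ln; apply/seteqP; split => g; last exact: Gnm_cycle.
move=> [[[g1 g2 g3 gE] gi] gl]; split => //; split => //; split => // e /gE.
by case: (Gnm_subgraph n m) => _; apply.
Qed.

Lemma Gnm_vertex_bound n m x : vset (Gnm G n m) x -> (x <= reach (maxn n m))%N.
Proof.
move=> /mem_Gnm_vset[g [l [ln cg /(visited_cycle cg)[i il ->]]]].
have /andP[_ H] := cycle_vertex cg il; apply: leq_trans H _.
by apply: reach_homo; rewrite leq_max; case: ln il => ?; lia.
Qed.

Lemma Gnm_finite n m : finite_graph (Gnm G n m).
Proof.
apply: (@sub_finite_set _ _ `I_(reach (maxn n m)).+1); last exact: finite_II.
by move=> x /Gnm_vertex_bound; rewrite /= ltnS.
Qed.

Lemma Gnm_connected n m : connected_graph (Gnm G n m).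
Proof.
move=> u w /mem_Gnm_vset[g [l [ln cg gu]]] /mem_Gnm_vset[g' [l' [ln' cg' gw]]].
have [_ u1] := cycle_connects (Gnm_cycle ln cg) gu.
have [w1 _] := cycle_connects (Gnm_cycle ln' cg') gw.
exact: is_path_trans u1 w1.
Qed.

(** The edge (x, 1) closes one of the generating cycles, and x is the vertex
    visited just before the end: it is bounded by [reach n] for a cycle of length
    at most n, and it is at least m for a cycle of length m. *)
Lemma Gnm_home n m x : (0 < n)%N -> eset (Gnm G n m) (x, 1%N) ->
  (x <= reach n)%N \/ (m <= x)%N.
Proof.
move=> n0 /mem_Gnm[g [l [ln cg /path_edgesP[i + [xE x1]]]]].
have [[_ gi] gl] := cg; rewrite gl => il.
have /andP[ix xi] := cycle_vertex cg il; rewrite -xE in ix xi.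
have li : l = i.+1.
  move: (il); rewrite leq_eqVlt => /predU1P[//|il'].
  by case: (gi i.+1); rewrite ?gl.
case: ln => ln; last by right; lia.
by left; apply: leq_trans xi _; apply: reach_homo; lia.
Qed.

Lemma chain_path i : path (edge_rel G) 1%N (iota 2 i) /\ last 1%N (iota 2 i) = i.+1.
Proof.
elim: i => // i [IH1 IH2].
have -> : iota 2 i.+1 = iota 2 i ++ [:: i.+2] by rewrite -(addn1 i) iotaD addn1.
rewrite cat_path last_cat IH1 IH2 /= andbT; split => //.
by apply/mem_set/nextG.
Qed.

Lemma one_notin_iota i : 1%N \notin iota 2 i.
Proof. by rewrite mem_iota. Qed.

(** The edge (x, y) lies on the cycle 1 -> 2 -> ... -> x -> y -> 1, where the last
    edge is dropped if y = 1. *)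
Lemma edge_in_cycle x y : eset G (x, y) ->
  exists g l, simple_cycles G 1 l g /\ (x, y) \in path_edges g.
Proof.
move=> xy; have [x0 y1 _] := edgeG xy.
have [cp cl] := chain_path x.-1; rewrite prednK // in cl.
suff [t [pt nt et]] : exists t, [/\ path (edge_rel G) 1%N (rcons t 1%N), 1%N \notin t &
    (x, y) \in path_edges (1%N, rcons t 1%N)].
  by exists (1%N, rcons t 1%N), (size t).+1; split=> //; exact: simple_cycle_rcons.
have edge s t w : (last w s, y) \in path_edges (w, s ++ y :: t).
  elim: s w => [|a s IH] w; first by rewrite path_edges_cons mem_head.
  by rewrite path_edges_cons inE IH orbT.
have [yE|y1'] := eqVneq y 1%N.
  exists (iota 2 x.-1); split; rewrite ?one_notin_iota //.
    by rewrite rcons_path cp cl; apply/mem_set/homeG.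
  by rewrite -cats1 -{1}cl -{1}yE -yE; exact: edge.
exists (rcons (iota 2 x.-1) y); split.
- rewrite !rcons_path cp cl last_rcons /=; apply/andP; split; first exact/mem_set.
  by apply/mem_set/homeG; case: y1 => [->//|]; apply: leq_ltn_trans.
- by rewrite mem_rcons inE eq_sym negb_or y1' one_notin_iota.
- by rewrite -{1}cl -cats1 cat_rcons; exact: edge.
Qed.

Lemma Gnm_exhaustive (n : nat -> nat) : (forall k, (n k < n k.+1)%N) ->
  exhaustive G (fun k => Gnm G (n k) (n k.+1)).
Proof.
move=> n_lt.
have n_ge k : (k <= n k)%N.
  by elim: k => // k IH; exact: leq_ltn_trans IH (n_lt k).
split=> [k|k||].
- exact: Gnm_subgraph.
- have le l : (l <= n k)%N \/ l = n k.+1 -> (l <= n k.+1)%N \/ l = n k.+2.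
    by move=> [lk|->]; left => //; apply: leq_trans lk (ltnW _).
  split=> x.
    by move=> /mem_Gnm_vset[g [l [/le ln cg xg]]]; apply/mem_Gnm_vset; exists g, l.
  by move=> /mem_Gnm[g [l [/le ln cg xg]]]; apply/mem_Gnm; exists g, l.
- apply/seteqP; split=> x.
    by case=> k _; case: (Gnm_subgraph (n k) (n k.+1)) => + _; apply.
  case: linG => + _ _ _ => /[apply] x0.
  have [g [l [cg xg]]] := edge_in_cycle (homeG x0).
  exists l => //; have [] := @esetP (Gnm G (n l) (n l.+1)) (x, 1%N) => //.
  by apply/mem_Gnm; exists g, l; split => //; left.
- apply/seteqP; split=> -[x y].
    by case=> k _; case: (Gnm_subgraph (n k) (n k.+1)) => _; apply.
  move=> /edge_in_cycle[g [l [cg xg]]].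
  exists l => //; apply/mem_Gnm; exists g, l; split=> //; by left.
Qed.

End Linear.

(** * Eigenvectors of a finite linear graph *)

Section Root.
Variables (R : realType) (B : nat -> nat -> R) (D : nat -> nat).
Hypothesis B_ge0 : forall x y, 0 <= B x y.

Lemma retsum_root u N : 0 < ret B D u 0 ->
  exists2 z, 0 < z & retsum B D u z N.+1 = 1.
Proof.
move=> r0; pose p := \sum_(n < N.+1) (ret B D u n)%:P * 'X^(n.+1) - 1%:P.
have pE z : p.[z] = retsum B D u z N.+1 - 1.
  rewrite /p hornerD hornerN hornerC horner_sum; congr (_ - _).
  by apply: eq_bigr => n _; rewrite hornerM hornerC hornerXn.
have b0 : 0 <= (ret B D u 0)^-1 by rewrite invr_ge0 ltW.
have [|z /andP[z0 _] /rootP] := @poly_ivt _ p 0 (ret B D u 0)^-1 b0.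
  apply/andP; split.
    rewrite pE /retsum big1 ?sub0r ?oppr_le0 // => n _.
    by rewrite expr0n /= mulr0.
  rewrite pE subr_ge0 /retsum big_ord_recl /= expr1 divff ?gt_eqF // lerDl.
  by apply: sumr_ge0 => n _; rewrite mulr_ge0 ?ret_ge0 ?exprn_ge0.
rewrite pE => /eqP; rewrite subr_eq0 => /eqP zE; exists z => //.
rewrite lt_neqAle z0 andbT; apply/eqP => z00; move: zE.
rewrite /retsum big1 => [/eqP|n _]; first by rewrite eq_sym oner_eq0.
by rewrite -z00 expr0n /= mulr0.
Qed.

(** Without first passages of exactly M + 1 steps from w, two consecutive
    truncations agree at w, and the shift of [hitsumS] disappears. *)
Lemma hitsum_harmonic u z M w : step B D (hit B D u M) w = 0 -> w != u ->
  z * step B D (hitsum B D u z M.+1) w = hitsum B D u z M.+1 w.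
Proof.
move=> h0 wu; rewrite -hitsumS // [LHS]big_ord_recr /=.
by rewrite (negPf wu) h0 mul0r addr0.
Qed.

End Root.

Section Bounds.
Variables (R : realType) (A B : nat -> nat -> R) (D E : nat -> nat).
Hypothesis B_ge0 : forall x y, 0 <= B x y.
Hypothesis B_D : forall x y, 0 < B x y -> (y < D x)%N.
Hypothesis B_E : forall x y, 0 < B x y -> (y < E x)%N.

Lemma step_widen (f : nat -> R) w n : (forall y, 0 < B w y -> (y < n)%N) ->
  forall m, (n <= m)%N ->
  \sum_(y < n) B w y * f y = \sum_(y < m) B w y * f y.
Proof.
move=> Bn m nm; rewrite (big_ord_widen _ (fun y => B w y * f y) nm) big_mkcond.
apply: eq_bigr => y _; case: ifPn => // yn; have := B_ge0 w y.
by rewrite le_eqVlt => /predU1P[<-|/Bn]; [rewrite mul0r|rewrite (negPf yn)].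
Qed.

Lemma step_eq_bound f w : step B D f w = step B E f w.
Proof.
rewrite /step (step_widen f (B_D (x := w)) (leq_addr (E w) _)).
by rewrite (step_widen f (B_E (x := w)) (leq_addl (D w) _)).
Qed.

Lemma hit_eq_bound u n w : hit B D u n w = hit B E u n w.
Proof.
elim: n w => //= n IH w; case: ifP => // _; rewrite step_eq_bound.
by congr step; apply/funext.
Qed.

Lemma ret_eq_bound u n : ret B D u n = ret B E u n.
Proof.
by rewrite /ret step_eq_bound; congr step; apply/funext => w; exact: hit_eq_bound.
Qed.

Hypothesis BA : forall x y, B x y <= A x y.

Lemma ret_le u n : ret B D u n <= ret A D u n.
Proof.
have stepBA f g w : (forall y, 0 <= f y) -> (forall y, f y <= g y) ->
    step B D f w <= step A D g w.
  by move=> f0 fg; apply: ler_sum => y _; rewrite ler_pM.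
have hit0 n' w : 0 <= hit B D u n' w by exact: hit_ge0.
apply: (stepBA) => // {}w; elim: n w => //= n IH w.
by case: ifP => // _; exact: stepBA.
Qed.

End Bounds.

Section FiniteLinear.
Variables (R : realType) (B : nat -> nat -> R) (N : nat).
Hypothesis B_ge0 : forall x y, 0 <= B x y.
Hypothesis B_N : forall x y, 0 < B x y -> (x < N)%N /\ (y < N)%N.
Hypothesis B_up : forall x y, 0 < B x y -> y = 1%N \/ (x < y)%N.

Local Notation bN := (fun _ : nat => N).
Local Notation Bt := (fun x y => B y x).

Lemma step_gt0_edge (C : nat -> nat -> R) D f w : (forall x y, 0 <= C x y) ->
  (forall y, 0 <= f y) -> 0 < step C D f w -> exists y, 0 < C w y /\ 0 < f y.
Proof.
move=> C0 f0 /lt0r_neq0; rewrite psumr_neq0; last by move=> y _; rewrite mulr_ge0.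
move=> /hasP[y _ /= ]; rewrite lt0r => /andP[+ _].
rewrite mulf_eq0 negb_or => /andP[Cy fy].
by exists y; rewrite !lt0r Cy fy C0 f0.
Qed.

(** Locates the vertex x from which a first passage to 1 in n + 1 steps makes its
    last step: the vertices increase until then and grow at most as iterates
    of E. *)
Lemma step_hit_gt0 n w E : {homo E : x y / (x <= y)%N} ->
  (forall x y, 0 < B x y -> (y <= E x)%N) ->
  0 < step B bN (hit B bN 1 n) w ->
  exists x, [/\ (w + n <= x)%N, (x <= iter n E w)%N & 0 < B x 1].
Proof.
move=> E_homo B_E; elim: n w => [|n IH] w /step_gt0_edge[|y|y [Bwy]]; rewrite ?ler0n //.
- rewrite /= ltr0n lt0b => /eqP y1; exists w; rewrite addn0; split=> //.
  by rewrite -y1.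
- exact: hit_ge0.
- rewrite /=; have [y1|y1] := eqVneq y 1%N; first by rewrite ltxx.
  move=> /IH[x [yx xy Bx]]; exists x; split=> //.
    have [/eqP|wy] := B_up Bwy; first by rewrite (negPf y1).
    by apply: leq_trans yx; rewrite addnS -addSn leq_add2r.
  apply: leq_trans xy _; rewrite -iterS iterSr.
  have : (y <= E w)%N by exact: B_E.
  by elim: (n) => //= k IHk /IHk; exact: E_homo.
Qed.

Lemma step_hit_eq0 n w : (N <= w + n)%N -> step B bN (hit B bN 1 n) w = 0.
Proof.
move=> Nn; apply/eqP; rewrite eq_le step_ge0 ?andbT; [|by []|by move=> y; exact: hit_ge0].
rewrite leNgt; apply/negP => /(@step_hit_gt0 _ _ (fun=> N))[//|x y /B_N[_ /ltnW //]|].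
move=> x [wx _ /B_N[]].
by move=> xN _; move: (leq_trans Nn wx); rewrite leqNgt xN.
Qed.

(** Read backwards, a path from 1 to w decreases from w, so it has fewer than w
    steps. *)
Lemma step_hitT_eq0 n w : w != 1%N -> (N <= n)%N -> step Bt bN (hit Bt bN 1 n) w = 0.
Proof.
move=> w1 Nn; apply/eqP; rewrite eq_le step_ge0 ?andbT; [|by []|by move=> y; exact: hit_ge0].
rewrite leNgt; apply/negP => H.
have wN : (w < N)%N.
  by have [//| |y [/B_N[]]] := step_gt0_edge _ _ H; first by move=> y; exact: hit_ge0.
suff : (n < w)%N by move=> /ltn_trans/(_ wN); rewrite ltnNge Nn.
elim: n w {Nn wN} w1 H => [|n IH] w w1 /step_gt0_edge[//| |y [Byw]].
- by move=> y; exact: hit_ge0.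
- rewrite /= ltr0n lt0b => /eqP yE; have [/eqP|] := B_up Byw; last by rewrite yE; lia.
  by rewrite (negPf w1).
- by move=> y; exact: hit_ge0.
- rewrite /=; have [y1|y1] := eqVneq y 1%N; first by rewrite ltxx.
  move=> /(IH _ y1) ny; have [/eqP|] := B_up Byw; first by rewrite (negPf w1).
  exact: leq_trans.
Qed.

Variable z : R.
Hypothesis z_gt0 : 0 < z.
Hypothesis z_root : retsum B bN 1 z N.+1 = 1.
Hypothesis N_gt1 : (1 < N)%N.

(** Right and left eigenvectors for the eigenvalue 1/z, both equal to 1 at the
    vertex 1: generating functions of the paths from w to 1, and from 1 to w, that meet 1
    only once. *)
Definition rvec (w : nat) : R := hitsum B bN 1 z N.+1 w.
Definition lvec (w : nat) : R := hitsum Bt bN 1 z N.+1 w.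

Let z_ge0 : 0 <= z := ltW z_gt0.
Let Bt_ge0 x y : 0 <= Bt x y := B_ge0 y x.

Lemma rvec1 : rvec 1 = 1.
Proof. exact: hitsum_target. Qed.

Lemma lvec1 : lvec 1 = 1.
Proof. exact: hitsum_target. Qed.

Lemma rvec_ge0 w : 0 <= rvec w.
Proof. exact: hitsum_ge0. Qed.

Lemma lvec_ge0 w : 0 <= lvec w.
Proof. exact: hitsum_ge0. Qed.

Lemma rvec_eigen w : z * step B bN rvec w = rvec w.
Proof.
have [->|w1] := eqVneq w 1%N; first by rewrite rvec1 -retsumE.
by apply: hitsum_harmonic => //; apply: step_hit_eq0; exact: leq_addl.
Qed.

Lemma step_adjoint (l r : nat -> R) :
  \sum_(w < N) l w * step B bN r w = \sum_(y < N) step Bt bN l y * r y.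
Proof.
rewrite /step; under eq_bigr do rewrite mulr_sumr.
rewrite exchange_big /=; apply: eq_bigr => y _.
by rewrite mulr_suml; apply: eq_bigr => w _; ring.
Qed.

(** At the vertex 1 the left equation does not come from the recursion.  It follows
    from the equations at the other vertices by pairing with the right
    eigenvector. *)
Lemma lvec_eigen w : z * step Bt bN lvec w = lvec w.
Proof.
have off v : v != 1%N -> z * step Bt bN lvec v = lvec v.
  by move=> v1; apply: hitsum_harmonic => //; exact: step_hitT_eq0.
have [->|] := eqVneq w 1%N; last exact: off.
pose i1 : 'I_N := Ordinal N_gt1.
have : \sum_(w < N) lvec w * rvec w = \sum_(w < N) (z * step Bt bN lvec w) * rvec w.
  under eq_bigr do rewrite -rvec_eigen mulrCA.
  rewrite -mulr_sumr step_adjoint mulr_sumr.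
  by apply: eq_bigr => y _; rewrite mulrA.
rewrite (bigD1 i1) //= [RHS](bigD1 i1) //= rvec1 !mulr1.
rewrite (@eq_bigr _ _ _ _ _ (fun i : 'I_N => i != i1) (fun i => lvec i * rvec i)
  (fun i => z * step Bt bN lvec i * rvec i)); first by move=> /addIr.
by move=> i i1'; rewrite off.
Qed.

Lemma rvec_edge w y : z * B w y * rvec y <= rvec w.
Proof.
have := B_ge0 w y; rewrite le_eqVlt => /predU1P[<-|Bwy].
  by rewrite mulr0 mul0r rvec_ge0.
rewrite -[leRHS]rvec_eigen -mulrA ler_wpM2l //.
by apply: le_step1 => //; [exact: rvec_ge0|case: (B_N Bwy)].
Qed.

Lemma lvec_edge w y : z * B w y * lvec w <= lvec y.
Proof.
have := B_ge0 w y; rewrite le_eqVlt => /predU1P[<-|Bwy].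
  by rewrite mulr0 mul0r lvec_ge0.
rewrite -[leRHS]lvec_eigen -mulrA ler_wpM2l //.
by apply: (@le_step1 _ Bt bN Bt_ge0); [exact: lvec_ge0|case: (B_N Bwy)].
Qed.

Lemma rvec_gt0 w s : path (fun x y => 0 < B x y) w s -> last w s = 1%N -> 0 < rvec w.
Proof.
elim: s w => [|y s IH] w /=; first by move=> _ ->; rewrite rvec1.
move=> /andP[Bwy /IH H /H ry]; apply: lt_le_trans (rvec_edge w y).
by rewrite !mulr_gt0.
Qed.

Lemma lvec_gt0 w s : path (fun x y => 0 < B x y) w s -> 0 < lvec w -> 0 < lvec (last w s).
Proof.
elim: s w => //= y s IH w /andP[Bwy /IH H lw]; apply: H.
by apply: lt_le_trans (lvec_edge w y); rewrite !mulr_gt0.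
Qed.

(** The mean length of an excursion from 1, that is, the inverse of the
    equilibrium probability of the vertex 1. *)
Definition total_mass : R := \sum_(w < N) lvec w * rvec w.

Lemma total_mass_gt0 : 0 < total_mass.
Proof.
rewrite /total_mass (bigD1 (Ordinal N_gt1)) //= lvec1 rvec1 mulr1 ltr_pwDl //.
by apply: sumr_ge0 => i _; rewrite mulr_ge0 ?lvec_ge0 ?rvec_ge0.
Qed.

(** Both sides are the probability that an excursion from 1 is longer than t. *)
Lemma survival t :
  \sum_(w < N) lvec w * (step B bN (hit B bN 1 t) w * z ^+ t.+1) =
  1 - retsum B bN 1 z t.
Proof.
elim: t => [|t IH].
  rewrite retsum0 subr0 -[RHS]lvec1 -[RHS]lvec_eigen.
  under eq_bigr do rewrite expr1 mulrA.
  rewrite -mulr_suml step_adjoint mulrC; congr (_ * _).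
  rewrite (bigD1 (Ordinal N_gt1)) //= mulr1 big1 ?addr0 // => y y1.
  by rewrite (_ : (y == 1%N :> nat) = false) ?mulr0 //; apply/negbTE.
rewrite retsumS opprD addrA -IH.
under eq_bigr do rewrite mulrA.
rewrite -mulr_suml step_adjoint mulr_suml.
transitivity (\sum_(y < N) lvec y * (hit B bN 1 t.+1 y * z ^+ t.+1)).
  by apply: eq_bigr => y _; rewrite -[lvec y in RHS]lvec_eigen exprS; ring.
rewrite (bigD1 (Ordinal N_gt1)) //= [in RHS](bigD1 (Ordinal N_gt1)) //= mul0r mulr0 add0r.
rewrite lvec1 mul1r addrAC subrr add0r; apply: eq_bigr => y y1.
by rewrite (_ : (y == 1%N :> nat) = false) //; apply/negbTE.
Qed.

(** A mean is at least the sum over t < L of the probabilities to exceed t, and each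
    of these is at least the probability to exceed L. *)
Lemma total_mass_ge L : L%:R * (1 - retsum B bN 1 z L) <= total_mass.
Proof.
apply: le_trans (_ : \sum_(t < L) \sum_(w < N)
    lvec w * (step B bN (hit B bN 1 t) w * z ^+ t.+1) <= _).
  under [leRHS]eq_bigr do rewrite survival.
  rewrite mulr_natl.
  have <- : \sum_(t < L) (1 - retsum B bN 1 z L) = (1 - retsum B bN 1 z L) *+ L.
    by rewrite sumr_const card_ord.
  apply: ler_sum => t _; apply: lerB => //; apply: retsum_mono => //.
  exact: ltnW (ltn_ord t).
rewrite exchange_big /=; apply: ler_sum => w _.
rewrite -mulr_sumr ler_wpM2l ?lvec_ge0 // -step_hitsum -[leRHS]rvec_eigen ler_wpM2l //.
apply: step_le => // y; apply: hitsum_le_super => //; first exact: rvec_ge0.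
  by rewrite rvec1.
by move=> v _; rewrite rvec_eigen.
Qed.

(** Weight of the cycle 1 -> 2 -> ... -> w -> 1, with a factor r for each edge. *)
Definition chain_weight (r : R) w := (\prod_(1 <= i < w) (r * B i i.+1)) * (r * B w 1).

(** The edges 1 -> 2 -> ... -> w compare the values of the right eigenvector at 1
    and w, and the edge w -> 1 those of the left one. *)
Lemma chain_weight_le (r : R) w : 0 < r -> r <= z -> (0 < w)%N ->
  chain_weight r w * (lvec w * rvec w) <= 1.
Proof.
move=> r0 rz w0; have r00 := ltW r0.
have H : \prod_(1 <= i < w) (r * B i i.+1) * rvec w <= 1.
  case: w w0 => // w _; elim: w => [|w IH]; first by rewrite big_geq // mul1r rvec1.
  rewrite big_nat_recr //=; apply: le_trans IH; rewrite -mulrA ler_wpM2l //.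
    by apply: prodr_ge0 => i _; rewrite mulr_ge0.
  by apply: le_trans (rvec_edge _ w.+2); rewrite ler_wpM2r ?rvec_ge0 // ler_wpM2r.
have H' : r * B w 1 * lvec w <= 1.
  rewrite -[leRHS]lvec1; apply: le_trans (lvec_edge w _).
  by rewrite ler_wpM2r ?lvec_ge0 // ler_wpM2r.
have -> : chain_weight r w * (lvec w * rvec w) =
  (\prod_(1 <= i < w) (r * B i i.+1) * rvec w) * (r * B w 1 * lvec w).
  by rewrite /chain_weight; ring.
rewrite mulr_ile1 //.
- by rewrite mulr_ge0 ?rvec_ge0 //; apply: prodr_ge0 => i _; rewrite mulr_ge0.
- by rewrite mulr_ge0 ?lvec_ge0 // mulr_ge0.
Qed.

End FiniteLinear.

(** * Drawing a discrete process from the unit interval *)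

Section Process.
Variables (R : realType) (N : nat) (p : seq nat -> R).
Hypothesis p_ge0 : forall s, 0 <= p s.
Hypothesis p_nil : p [::] = 1.
Hypothesis p_rcons : forall s : seq nat, \sum_(x < N) p (rcons s x) = p s.

(** Left end of the interval attached to the word s.  The interval of s is cut
    from left to right into the intervals of the words [rcons s x], so this end is
    shifted, at each letter, by the lengths of the siblings on the left. *)
Definition cell_left (s : seq nat) : R :=
  \sum_(i < size s) \sum_(y < nth 0%N s i) p (rcons (take i s) y).

Definition cell (s : seq nat) : interval R := `[cell_left s, cell_left s + p s[.

Let cut (s : seq nat) (x : nat) : R := cell_left s + \sum_(y < x) p (rcons s y).

Lemma cell_left_rcons s x : cell_left (rcons s x) = cut s x.
Proof.
rewrite /cut /cell_left size_rcons big_ord_recr /= nth_rcons ltnn eqxx -cats1.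
rewrite take_size_cat //; congr (_ + _); apply: eq_bigr => i _.
by rewrite nth_cat ltn_ord takel_cat // ltnW.
Qed.

Lemma mem_cell_rcons t s x : (t \in cell (rcons s x)) = (cut s x <= t < cut s x.+1).
Proof.
rewrite /cell in_itv /= cell_left_rcons; congr (_ && (_ < _)).
by rewrite /cut big_ord_recr /= addrA.
Qed.

Lemma cut_homo s x y : (x <= y)%N -> cut s x <= cut s y.
Proof.
apply: (@homo_leq _ _ <=%R (@lexx _ _) (@le_trans _ _)) => {x y} x.
by rewrite lerD2l big_ord_recr /= lerDl.
Qed.

Definition next_letter (t : R) (s : seq nat) : nat :=
  find (fun x => t < cell_left (rcons s x) + p (rcons s x)) (iota 0 N).

Lemma next_pred t s x : (t < cell_left (rcons s x) + p (rcons s x)) = (t < cut s x.+1).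
Proof. by rewrite cell_left_rcons /cut big_ord_recr /= addrA. Qed.

Lemma before_next t s x : (x < next_letter t s)%N -> cut s x.+1 <= t.
Proof.
move=> xn; have := before_find 0%N xn.
rewrite nth_iota; last by apply: leq_trans xn _; rewrite -[leqRHS](size_iota 0) find_size.
by rewrite next_pred add0n leNgt => ->.
Qed.

Lemma next_letter_cell t s : t \in cell s ->
  (next_letter t s < N)%N /\ t \in cell (rcons s (next_letter t s)).
Proof.
rewrite /cell in_itv /= -p_rcons -/(cut s N) => /andP[lt tN].
have hasN : has (fun x => t < cell_left (rcons s x) + p (rcons s x)) (iota 0 N).
  apply/hasP; move: tN; case: (N) => [|M tM].
    by rewrite /cut big_ord0 addr0 ltNge lt.
  by exists M; rewrite ?next_pred // mem_iota /= ltnSn.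
have nN : (next_letter t s < N)%N by rewrite -[leqRHS](size_iota 0) -has_find.
split=> //; rewrite -/(cell _) mem_cell_rcons; apply/andP; split.
  case E : (next_letter t s) => [|x]; first by rewrite /cut big_ord0 addr0.
  by apply: before_next; rewrite E.
by have := nth_find 0%N hasN; rewrite nth_iota // next_pred.
Qed.

Lemma cell_rcons_next t s x : (x < N)%N -> t \in cell (rcons s x) ->
  t \in cell s /\ next_letter t s = x.
Proof.
rewrite mem_cell_rcons => xN /andP[xt tx]; split.
  rewrite in_itv /= -p_rcons -/(cut s N); apply/andP; split.
    by apply: le_trans xt; have := @cut_homo s 0 x isT; rewrite {1}/cut big_ord0 addr0.
  exact: lt_le_trans tx (cut_homo _ _).
apply/eqP; rewrite eqn_leq; apply/andP; split; rewrite leqNgt; apply/negP => H.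
  by have := before_next H; rewrite leNgt tx.
have hasN : has (fun x => t < cell_left (rcons s x) + p (rcons s x)) (iota 0 N).
  by rewrite has_find -/(next_letter t s) size_iota (ltn_trans H).
have := nth_find 0%N hasN; rewrite -/(next_letter t s) nth_iota ?(ltn_trans H) //.
by rewrite next_pred ltNge (le_trans (cut_homo _ H)).
Qed.

Fixpoint word (t : R) (n : nat) : seq nat :=
  if n is n'.+1 then rcons (word t n') (next_letter t (word t n')) else [::].

Lemma size_word t n : size (word t n) = n.
Proof. by elim: n => //= n IH; rewrite size_rcons IH. Qed.

Lemma word_cell t n : t \in `[0, 1[%R ->
  t \in cell (word t n) /\ all (fun x => x < N)%N (word t n).
Proof.
move=> t01; elim: n => [|n [IH1 IH2]].
  by rewrite /cell /cell_left big_ord0 add0r p_nil.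
by have [nN tc] := next_letter_cell IH1; rewrite /= all_rcons nN IH2.
Qed.

Lemma word_gt0 t n : t \in `[0, 1[%R -> 0 < p (word t n).
Proof.
move=> /(word_cell n)[+ _]; rewrite in_itv /= => /andP[H1 H2].
by have := le_lt_trans H1 H2; rewrite ltrDl.
Qed.

(** The intervals of the words of a given length partition [0, 1[. *)
Lemma word_eq t s : t \in `[0, 1[%R -> all (fun x => x < N)%N s ->
  (word t (size s) == s) = (t \in cell s).
Proof.
move=> t01; elim/last_ind: s => [_|s x IH].
  by rewrite eqxx; have [-> _] := word_cell 0 t01.
rewrite all_rcons size_rcons /= => /andP[xN /IH IHs].
apply/idP/idP => [|/(cell_rcons_next xN)[]].
  rewrite eqseq_rcons => /andP[/eqP sE /eqP xE].
  by rewrite -{1}xE; have := IHs; rewrite sE eqxx => /esym/next_letter_cell[].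
by rewrite -IHs => /eqP -> ->.
Qed.

Definition letter (t : R) (k : nat) : nat := nth 0%N (word t k.+1) k.

Lemma nth_word t n k : (k < n)%N -> nth 0%N (word t n) k = letter t k.
Proof.
elim: n => // n IH; rewrite ltnS leq_eqVlt => /predU1P[->//|kn].
by rewrite /= nth_rcons size_word kn IH.
Qed.

Lemma letter_ltN t k : t \in `[0, 1[%R -> (letter t k < N)%N.
Proof.
move=> /(word_cell k.+1)[_ /allP]; apply.
by rewrite /letter mem_nth // size_word.
Qed.

Lemma letters_cell t s : t \in `[0, 1[%R -> all (fun x => x < N)%N s ->
  (forall k, (k < size s)%N -> letter t k = nth 0%N s k) <-> t \in cell s.
Proof.
move=> t01 sN; rewrite -word_eq //; split=> [H|/eqP <- k].
  apply/eqP/(@eq_from_nth _ 0%N); rewrite size_word // => k ks.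
  by rewrite nth_word // H.
by rewrite size_word => ks; rewrite nth_word.
Qed.

Lemma cell_sub01 s : all (fun x => x < N)%N s -> {subset cell s <= `[0, 1[%R}.
Proof.
move=> + t; elim/last_ind: s => [_|s x IH].
  by rewrite /cell /cell_left big_ord0 add0r p_nil.
by rewrite all_rcons => /andP[xN /IH H] /(cell_rcons_next xN)[/H].
Qed.

End Process.

Section UnitInterval.
Variable R : realType.

Let measurable_unit : measurable (`[0, 1[%classic : set R).
Proof. exact: measurable_itv. Qed.

Definition unit_measure := mrestr (@lebesgue_measure R) measurable_unit.

HB.instance Definition _ := Measure.on unit_measure.

Lemma unit_measure_itv (a b : R) : 0 <= a -> a <= b -> b <= 1 ->
  unit_measure `[a, b[%classic = (b - a)%:E.
Proof.
move=> a0 ab b1; rewrite /unit_measure /mrestr setIidl => [|x].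
  rewrite lebesgue_measure_itv /= lte_fin -EFinB; case: ltgtP ab => // -> _.
  by rewrite subrr.
rewrite /= !in_itv /= => /andP[ax xb].
by rewrite (le_trans a0 ax) (lt_le_trans xb b1).
Qed.

Let unit_measure_setT : unit_measure setT = 1%E.
Proof.
rewrite -(subr0 (1 : R)) -unit_measure_itv ?lexx ?ler01 //.
by rewrite /unit_measure /mrestr setTI setIid.
Qed.

HB.instance Definition _ :=
  Measure_isProbability.Build _ _ R unit_measure unit_measure_setT.

(** Sends the points outside [0, 1[, which have measure zero, to 0: all statements
    about trajectories then hold for all points. *)
Definition clamp (t : R) : R := if t \in `[0, 1[%R then t else 0.

Lemma clamp01 t : clamp t \in `[0, 1[%R.
Proof. by rewrite /clamp; case: ifP => // _; rewrite in_itv /= lexx ltr01. Qed.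

Lemma clamp_preimage (A : set R) : measurable A -> A `<=` `[0, 1[ ->
  measurable (clamp @^-1` A) /\ unit_measure (clamp @^-1` A) = unit_measure A.
Proof.
move=> mA A01; have E : (clamp @^-1` A) `&` `[0, 1[ = A.
  apply/seteqP; split => t /=; first by rewrite /clamp => -[+ t01]; rewrite t01.
  by move=> At; have t01 := A01 _ At; split => //; rewrite /clamp /= in t01 *; rewrite t01.
split; last by rewrite /unit_measure /mrestr E setIidl.
have [A0|A0] := pselect (A 0).
  rewrite (_ : _ @^-1` _ = A `|` ~` `[0, 1[).
    by apply: measurableU => //; exact: measurableC.
  apply/seteqP; split => t /=; rewrite /clamp.
    by case: ifPn => [_ At|/negP]; [left|right].
  by case=> [At|/negP/negbTE ->//]; rewrite (A01 _ At : t \in `[0, 1[%R).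
rewrite (_ : _ @^-1` _ = A) //; apply/seteqP; split => t /=; rewrite /clamp.
  by case: ifPn.
by move=> At; rewrite (A01 _ At : t \in `[0, 1[%R).
Qed.

End UnitInterval.

Section Draw.
Variables (R : realType) (N : nat) (p : seq nat -> R).
Hypothesis p_ge0 : forall s, 0 <= p s.
Hypothesis p_nil : p [::] = 1.
Hypothesis p_rcons : forall s : seq nat, \sum_(x < N) p (rcons s x) = p s.

Definition draw (t : R) (k : nat) : nat := letter N p (clamp t) k.

Lemma draw_ltN t k : (draw t k < N)%N.
Proof. by apply: letter_ltN => //; exact: clamp01. Qed.

Lemma draw_gt0 t s : (forall k, (k < size s)%N -> draw t k = nth 0%N s k) -> 0 < p s.
Proof.
move=> H; suff -> : s = word N p (clamp t) (size s).
  by apply: word_gt0 => //; exact: clamp01.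
apply: (@eq_from_nth _ 0%N) => [|k ks]; first by rewrite size_word.
by rewrite nth_word // -H.
Qed.

Let drawE s : all (fun x => x < N)%N s ->
  [set t | forall k, (k < size s)%N -> draw t k = nth 0%N s k] =
  @clamp R @^-1` [set` cell p s].
Proof.
move=> sN; apply/seteqP; split => t /=.
  by move/letters_cell => -> //; exact: clamp01.
by move=> tc; apply/(letters_cell p_ge0 p_nil p_rcons _ sN) => //; exact: clamp01.
Qed.

Let cell_sub s : all (fun x => x < N)%N s -> [set` cell p s] `<=` `[0, 1[.
Proof. by move=> sN t /=; exact: (cell_sub01 p_ge0 p_nil p_rcons sN). Qed.

Lemma measurable_draw_word s : all (fun x => x < N)%N s ->
  measurable [set t | forall k, (k < size s)%N -> draw t k = nth 0%N s k].
Proof.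
by move=> sN; rewrite drawE //; apply: (clamp_preimage _ _).1 => //; exact: cell_sub.
Qed.

Lemma unit_measure_draw_word s : all (fun x => x < N)%N s ->
  unit_measure [set t | forall k, (k < size s)%N -> draw t k = nth 0%N s k] = (p s)%:E.
Proof.
move=> sN; rewrite drawE // (clamp_preimage _ _).2 //; last exact: cell_sub.
have [p0|p0] := eqVneq (p s) 0.
  rewrite p0 /cell p0 addr0 [X in unit_measure X](_ : _ = set0) ?measure0 //.
  by rewrite set_itvco0.
have pgt : 0 < p s by rewrite lt_neqAle eq_sym p0 p_ge0.
have left01 : cell_left p s \in `[0, 1[%R.
  by apply: (cell_sub01 p_ge0 p_nil p_rcons sN); rewrite in_itv /= lexx ltrDl.
rewrite /cell (@unit_measure_itv _ (cell_left p s) (cell_left p s + p s)).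
- by rewrite addrC addKr.
- by move: left01; rewrite in_itv => /andP[].
- by rewrite lerDl.
rewrite leNgt; apply/negP => H.
have left1 : cell_left p s < 1 by move: left01; rewrite in_itv /= => /andP[].
have : (1 : R) \in `[0, 1[%R.
  by apply: (cell_sub01 p_ge0 p_nil p_rcons sN); rewrite in_itv /= H ltW.
by rewrite in_itv /= ltxx andbF.
Qed.

(** A countable union of intervals: those of the words of length k + 1 that end
    with x. *)
Lemma measurable_draw k x : measurable [set t | draw t k = x].
Proof.
pose S (s : seq nat) : set R :=
  if (size s == k.+1) && (nth 0%N s k == x) && all (fun x => x < N)%N s
  then [set t | forall k, (k < size s)%N -> draw t k = nth 0%N s k] else set0.
rewrite (_ : [set _ | _] = \bigcup_s S s).
  apply: countable_bigcupT_measurable; first exact: countableP.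
  by move=> s; rewrite /S; case: ifP => // /andP[_ sN]; exact: measurable_draw_word.
apply/seteqP; split => t /=.
  move=> tx; exists (mkseq (draw t) k.+1) => //.
  have sN : all (fun x => x < N)%N (mkseq (draw t) k.+1).
    by apply/allP => _ /mapP[j _ ->]; exact: draw_ltN.
  rewrite /S sN size_mkseq nth_mkseq // tx !eqxx => j jk.
  by rewrite nth_mkseq.
move=> [s _]; rewrite /S; case: ifP => // /andP[/andP[/eqP sk /eqP <-] _] /= -> //.
by rewrite sk.
Qed.

End Draw.

(** * Stationary Markov measures on two-sided sequences *)

(** A process indexed by the integers is drawn one letter at a time, in the
    order 0, 1, -1, 2, -2, and so on of the coordinates, so that the letters
    drawn so far always fill a window, and each new letter extends that window
    by one, alternately to the right and to the left. *)
Definition rank_of (i : int) : nat := if 0 < i then (`|i|%N).*2.-1 else (`|i|%N).*2.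

(** The first k + 1 letters fill the window of the k + 1 coordinates that start
    at - k./2; these two maps are mutually inverse between positions in that
    window, read from the left, and ranks of drawing. *)
Definition window_rank (k i : nat) : nat :=
  if (i <= k./2)%N then (k./2 - i).*2 else (i - k./2).*2.-1.

Definition window_pos (k j : nat) : nat :=
  if odd j then (k./2 + j./2.+1)%N else (k./2 - j./2)%N.

Lemma rank_of_window k i : rank_of (- (k./2)%:Z + i%:Z) = window_rank k i.
Proof. rewrite /rank_of /window_rank; case: ifP; case: ifP => *; lia. Qed.

Lemma window_rank_le k i : (i <= k)%N -> (window_rank k i <= k)%N.
Proof. rewrite /window_rank; case: ifP => *; lia. Qed.

Lemma window_pos_le k j : (j <= k)%N -> (window_pos k j <= k)%N.
Proof. rewrite /window_pos; case: ifP => *; lia. Qed.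

Lemma window_posK k j : (j <= k)%N -> window_rank k (window_pos k j) = j.
Proof. rewrite /window_pos; case: ifP => ?; rewrite /window_rank; case: ifP => *; lia. Qed.

Lemma window_rankK k i : (i <= k)%N -> window_pos k (window_rank k i) = i.
Proof. rewrite /window_rank; case: ifP => ?; rewrite /window_pos; case: ifP => *; lia. Qed.

Section Markov.
Variables (R : realType) (B : nat -> nat -> R) (l r : nat -> R) (z : R) (N : nat).
Hypothesis B_ge0 : forall x y, 0 <= B x y.
Hypothesis B_N : forall x y, 0 < B x y -> (x < N)%N /\ (y < N)%N.
Hypothesis l_ge0 : forall x, 0 <= l x.
Hypothesis r_ge0 : forall x, 0 <= r x.
Hypothesis l_N : forall x, (N <= x)%N -> l x = 0.
Hypothesis z_gt0 : 0 < z.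
Hypothesis r_eigen : forall w, z * \sum_(y < N) B w y * r y = r w.
Hypothesis l_eigen : forall w, z * \sum_(y < N) B y w * l y = l w.
Hypothesis lr1 : \sum_(x < N) l x * r x = 1.

Definition markov_weight (k : nat) (u : nat -> nat) : R :=
  z ^+ k * l (u 0%N) * (\prod_(i < k) B (u i) (u i.+1)) * r (u k).

Lemma markov_weight_ge0 k u : 0 <= markov_weight k u.
Proof.
rewrite /markov_weight !mulr_ge0 ?exprn_ge0 ?(ltW z_gt0) //.
by apply: prodr_ge0 => i _.
Qed.

Lemma eq_markov_weight k u v : (forall i, (i <= k)%N -> u i = v i) ->
  markov_weight k u = markov_weight k v.
Proof.
move=> uv; rewrite /markov_weight !uv //; congr (_ * _ * _).
by apply: eq_bigr => i _; rewrite !uv // ltnW.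
Qed.

Definition extend_right (k : nat) (u : nat -> nat) (x i : nat) : nat :=
  if (i <= k)%N then u i else x.

Definition extend_left (u : nat -> nat) (x i : nat) : nat :=
  if i is j.+1 then u j else x.

(** Extending a word to the right is consistent because r is a right eigenvector,
    extending it to the left because l is a left one. *)
Lemma sum_extend_right k u :
  \sum_(x < N) markov_weight k.+1 (extend_right k u x) = markov_weight k u.
Proof.
rewrite [RHS]/markov_weight -r_eigen !mulr_sumr; apply: eq_bigr => x _.
have old i : (i <= k)%N -> extend_right k u x i = u i by rewrite /extend_right => ->.
have new : extend_right k u x k.+1 = x by rewrite /extend_right ltnn.
rewrite /markov_weight big_ord_recr /= new !old //.
under eq_bigr => i _ do rewrite (old _ (ltnW (ltn_ord i))) (old _ (ltn_ord i)).
by rewrite exprS; ring.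
Qed.

Lemma sum_extend_left k u :
  \sum_(x < N) markov_weight k.+1 (extend_left u x) = markov_weight k u.
Proof.
rewrite [RHS]/markov_weight -l_eigen !mulr_sumr !mulr_suml; apply: eq_bigr => x _.
by rewrite /markov_weight big_ord_recl /= exprS; ring.
Qed.

Lemma markov_weight_out k u i : (i <= k)%N -> (N <= u i)%N -> markov_weight k u = 0.
Proof.
case: i => [|i] ik Nu; first by rewrite /markov_weight l_N // mulr0 !mul0r.
rewrite /markov_weight (bigD1 (Ordinal ik)) //=.
have -> : B (u i) (u i.+1) = 0.
  apply/eqP; rewrite eq_le B_ge0 andbT leNgt; apply/negP => /B_N[_].
  by rewrite ltnNge Nu.
by rewrite mul0r mulr0 mul0r.
Qed.

(** Here s lists letters in the order of drawing, whereas [markov_weight] reads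
    them from left to right. *)
Definition word_weight (s : seq nat) : R :=
  if size s is k.+1 then markov_weight k (fun i => nth 0%N s (window_rank k i))
  else 1.

Lemma word_weight_ge0 s : 0 <= word_weight s.
Proof. by rewrite /word_weight; case: (size s) => // k; exact: markov_weight_ge0. Qed.

Lemma word_weight_rcons (s : seq nat) :
  \sum_(x < N) word_weight (rcons s x) = word_weight s.
Proof.
rewrite /word_weight; case sk : (size s) => [|k].
  move: sk => /eqP; rewrite size_eq0 => /eqP ->; rewrite -[RHS]lr1.
  apply: eq_bigr => x _.
  by rewrite /= /markov_weight /window_rank /= big_ord0 expr0 mul1r mulr1.
under eq_bigr => x _ do rewrite size_rcons sk.
have nthE x i : (i <= k)%N -> nth 0%N (rcons s x) i = nth 0%N s i.
  by rewrite nth_rcons sk ltnS => ->.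
have [k_odd|k_even] := boolP (odd k).
  rewrite -[RHS]sum_extend_left; apply: eq_bigr => x _.
  apply: eq_markov_weight => -[|i] ik /=.
    have -> : window_rank k.+1 0 = k.+1 by rewrite /window_rank /=; lia.
    by rewrite nth_rcons sk ltnn eqxx.
  have -> : window_rank k.+1 i.+1 = window_rank k i.
    by rewrite /window_rank; case: ifP; case: ifP; lia.
  by rewrite nthE // window_rank_le.
rewrite -[RHS](sum_extend_right k); apply: eq_bigr => x _.
apply: eq_markov_weight => i ik; rewrite /extend_right.
have -> : window_rank k.+1 i = window_rank k i.
  by rewrite /window_rank; have -> : k.+1./2 = k./2 by lia.
case: ifPn => [ik'|ik']; first by rewrite nthE // window_rank_le.
have -> : window_rank k i = k.+1 by rewrite /window_rank; case: ifP; lia.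
by rewrite nth_rcons sk ltnn eqxx.
Qed.

Lemma word_weight_edge s k i : size s = k.+1 -> 0 < word_weight s -> (i < k)%N ->
  0 < B (nth 0%N s (window_rank k i)) (nth 0%N s (window_rank k i.+1)).
Proof.
rewrite /word_weight => -> + ik; rewrite /markov_weight (bigD1 (Ordinal ik)) //=.
have := B_ge0 (nth 0%N s (window_rank k i)) (nth 0%N s (window_rank k i.+1)).
by rewrite le_eqVlt => /predU1P[<-|//]; rewrite mul0r mulr0 mul0r ltxx.
Qed.

Definition trajectory (t : measurableTypeR R) : path_space :=
  fun i => draw N word_weight t (rank_of i).

Let ww0 := word_weight_ge0.
Let ww1 : word_weight [::] = 1 := erefl.
Let wwr := word_weight_rcons.

(** Words of weight zero have empty intervals, so this holds for all points and
    not merely for almost all. *)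
Lemma trajectory_edge t i : 0 < B (trajectory t i) (trajectory t (i + 1)).
Proof.
pose m := `|i|.+1%N; pose k := m.*2; pose s := mkseq (draw N word_weight t) k.+1.
have k2 : k./2 = m by rewrite doubleK.
pose j := absz (i + m%:Z).
have jk : (j < k)%N by rewrite /j /k /m; lia.
have posj : i = - (k./2)%:Z + j%:Z by rewrite k2 /j /m; lia.
have ws : 0 < word_weight s.
  apply: (draw_gt0 ww1 wwr (t := t)) => q; rewrite size_mkseq => qk.
  by rewrite nth_mkseq.
have := word_weight_edge (size_mkseq _ _ : size s = k.+1) ws jk.
rewrite !nth_mkseq ?ltnS ?window_rank_le // ?(ltnW jk) //.
rewrite /trajectory -!rank_of_window -posj.
by have -> : - (k./2)%:Z + (j.+1)%:Z = i + 1 by rewrite posj; lia.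
Qed.

Lemma measurable_trajectory : measurable_fun setT trajectory.
Proof.
apply: (@measurability _ _ _ path_space _ _
  [set C | exists s t u, C = coord_cylinder s t u]) => //.
move=> _ [_ [s [t [u ->]]] <-]; rewrite setTI.
rewrite (_ : _ @^-1` _ = \bigcap_(i in [set i | (i <= t)%N])
  [set x | draw N word_weight x (rank_of (s + i%:Z)) = u i]).
  by apply: bigcap_measurableType => i _; exact: measurable_draw.
by apply/seteqP; split => x /= H i /H.
Qed.

Let trajectory_mfun : {mfun measurableTypeR R >-> path_space} :=
  mfun_Sub (mem_set measurable_trajectory).

Definition markov_measure : probability path_space R :=
  distribution (@unit_measure R) trajectory_mfun.

Lemma markov_measureE (A : set path_space) :
  markov_measure A = unit_measure (trajectory @^-1` A).
Proof. by []. Qed.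

Definition admissible_paths : set path_space :=
  [set omega | forall i, 0 < B (omega i) (omega (i + 1))].

Lemma markov_measure_admissible A :
  markov_measure (admissible_paths `&` A) = markov_measure A.
Proof.
rewrite !markov_measureE; congr unit_measure.
by apply/seteqP; split => t /=; [case|split => // i; exact: trajectory_edge].
Qed.

Lemma measurable_coord_cylinder a k u :
  measurable (coord_cylinder a k u : set path_space).
Proof. by apply: sub_sigma_algebra; exists a, k, u. Qed.

Let markov_window k u :
  markov_measure (coord_cylinder (- (k./2)%:Z) k u) = (markov_weight k u)%:E.
Proof.
rewrite markov_measureE.
have [uN|[i [ik iN]]] : (forall i, (i <= k)%N -> (u i < N)%N) \/
    exists i, (i <= k)%N /\ (N <= u i)%N.
- have [H|] := pselect (forall i, (i <= k)%N -> (u i < N)%N); first by left.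
  move=> /existsNP[i /not_implyP[ik iN]].
  by right; exists i; split=> //; rewrite leqNgt; apply/negP.
- have [s [sz snth]] : exists s, size s = k.+1 /\
      forall j, (j <= k)%N -> nth 0%N s j = u (window_pos k j).
    exists (mkseq (fun j => u (window_pos k j)) k.+1); rewrite size_mkseq.
    by split => // j jk; rewrite nth_mkseq.
  have sN : all (fun x => x < N)%N s.
    apply/(all_nthP 0%N) => j; rewrite sz ltnS => jk.
    by rewrite snth // uN // window_pos_le.
  have -> : markov_weight k u = word_weight s.
    rewrite /word_weight sz; apply: eq_markov_weight => i ik.
    by rewrite snth ?window_rank_le // window_rankK.
  rewrite -(unit_measure_draw_word ww0 ww1 wwr sN); congr unit_measure.
  apply/seteqP; rewrite sz; split => t /= H.
    move=> j; rewrite ltnS => jk.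
    by rewrite snth // -H ?window_pos_le // /trajectory rank_of_window window_posK.
  move=> i ik; rewrite /trajectory rank_of_window H ?ltnS ?window_rank_le //.
  by rewrite snth ?window_rank_le // window_rankK.
- rewrite (markov_weight_out ik iN) [X in unit_measure X](_ : _ = set0) ?measure0 //.
  apply/seteqP; split => // t /= /(_ _ ik) H.
  have := @draw_ltN R N word_weight ww1 wwr t (rank_of (- (k./2)%:Z + i%:Z)).
  by rewrite -[draw _ _ _ _]/(trajectory t _) H ltnNge iN.
Qed.

(** On trajectories, a cylinder is a finite disjoint union of cylinders over a
    larger window, because the alphabet is finite. *)
Let markov_split a k u b (v : nat -> nat -> nat) j :
  (forall x, coord_cylinder b k.+1 (v x) =
    coord_cylinder a k u `&` [set omega | omega j = x]) ->
  (forall x, markov_measure (coord_cylinder b k.+1 (v x)) =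
    (markov_weight k.+1 (v x))%:E) ->
  markov_measure (coord_cylinder a k u) = (\sum_(x < N) markov_weight k.+1 (v x))%:E.
Proof.
move=> vE mE; pose F (x : nat) : set path_space := coord_cylinder b k.+1 (v x).
have mF x : measurable (F x) by exact: measurable_coord_cylinder.
rewrite -sumEFin; under eq_bigr do rewrite -mE.
have <- := @measure_semi_additive_ord_I _ _ _ markov_measure F N (fun x _ => mF x).
- rewrite !markov_measureE; congr unit_measure; apply/seteqP; split => t /=.
    move=> H; rewrite -bigcup_mkord /=; exists (trajectory t j); last by rewrite /F vE.
    exact: draw_ltN.
  by rewrite -bigcup_mkord => -[x _]; rewrite /F vE => -[].
- apply/trivIsetP => x y _ _ xy; rewrite /F !vE.
  apply/seteqP; split => // omega [[_ /= +] [_ /=]].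
  by move=> -> /eqP; rewrite (negPf xy).
- exact: bigsetU_measurable.
Qed.

Let markov_drop_right a k :
  (forall u, markov_measure (coord_cylinder a k.+1 u) = (markov_weight k.+1 u)%:E) ->
  forall u, markov_measure (coord_cylinder a k u) = (markov_weight k u)%:E.
Proof.
move=> H u; rewrite -(sum_extend_right k u).
apply: (@markov_split a k u a (extend_right k u) (a + k.+1%:Z)) => // x.
rewrite /extend_right; apply/seteqP; split => omega /=.
  move=> Ho; split; last by rewrite Ho // ltnn.
  by move=> i ik; rewrite Ho ?ik // leqW.
move=> [Ho ox] i; rewrite leq_eqVlt => /predU1P[->|]; first by rewrite ltnn.
by rewrite ltnS => ik; rewrite ik Ho.
Qed.

Let markov_drop_left a k :
  (forall u, markov_measure (coord_cylinder a k.+1 u) = (markov_weight k.+1 u)%:E) ->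
  forall u, markov_measure (coord_cylinder (a + 1) k u) = (markov_weight k u)%:E.
Proof.
move=> H u; rewrite -(sum_extend_left k u).
apply: (@markov_split (a + 1) k u a (extend_left u) a) => // x.
have aE i : a + 1 + i%:Z = a + i.+1%:Z by lia.
apply/seteqP; split => omega /=.
  move=> Ho; split; last by have := Ho 0%N isT; rewrite addr0.
  by move=> i ik; rewrite aE Ho.
move=> [Ho ox] [|i] ik; first by rewrite addr0.
by rewrite -aE Ho.
Qed.

(** A window is contained in a symmetric one, from which it is obtained by dropping
    coordinates on the right, then on the left. *)
Lemma markov_measure_cylinder a k u :
  markov_measure (coord_cylinder a k u) = (markov_weight k u)%:E.
Proof.
have right b m d :
    (forall u, markov_measure (coord_cylinder b (m + d) u) = (markov_weight (m + d) u)%:E) ->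
    forall u, markov_measure (coord_cylinder b m u) = (markov_weight m u)%:E.
  elim: d => [|d IH]; first by rewrite addn0.
  by rewrite addnS => /markov_drop_right/IH.
have left b m d :
    (forall u, markov_measure (coord_cylinder b (m + d) u) = (markov_weight (m + d) u)%:E) ->
    forall u, markov_measure (coord_cylinder (b + d%:Z) m u) = (markov_weight m u)%:E.
  elim: d b => [|d IH] b; first by rewrite addn0 addr0.
  rewrite addnS => /markov_drop_left/IH.
  by have -> : b + 1 + d%:Z = b + d.+1%:Z by lia.
pose M := (`|a|%N + k)%N; pose d := absz (a + M%:Z).
have aE : a = - M%:Z + d%:Z by rewrite /d /M; lia.
rewrite {1}aE; apply: left; apply: (right _ _ (M.*2 - (k + d))%N).
have -> : (k + d + (M.*2 - (k + d)) = M.*2)%N by rewrite /d /M; lia.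
by move=> v; rewrite -[X in - X%:Z](doubleK M) markov_window.
Qed.

End Markov.

(** * Equilibrium measures of finite linear graphs *)

Section Equilibrium.
Variables (R : realType) (H : digraph) (W : nat * nat -> R) (N : nat) (z : R).
Hypothesis W_gt0 : forall e, eset H e -> 0 < W e.
Hypothesis H_N : forall x, vset H x -> (x < N)%N.
Hypothesis H_up : forall x y, eset H (x, y) -> y = 1%N \/ (x < y)%N.
Hypothesis H_1 : vset H 1.
Hypothesis H_conn : connected_graph H.
Hypothesis z_gt0 : 0 < z.

Local Notation B := (adj H W).
Local Notation bN := (fun _ : nat => N).

Hypothesis z_root : retsum B bN 1 z N.+1 = 1.

Let B_ge0 : forall x y, 0 <= B x y.
Proof. exact: adj_ge0. Qed.

Let B_edge x y : 0 < B x y <-> eset H (x, y).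
Proof. exact: adj_gt0. Qed.

Lemma adj_N x y : 0 < B x y -> (x < N)%N /\ (y < N)%N.
Proof. by move=> /B_edge/esetP[/H_N ? /H_N]. Qed.

Lemma adj_up x y : 0 < B x y -> y = 1%N \/ (x < y)%N.
Proof. by move=> /B_edge/H_up. Qed.

Lemma adj_off x y : ~ (vset H x /\ vset H y) -> B x y = 0.
Proof.
move=> nv; apply/eqP; rewrite eq_le B_ge0 andbT leNgt; apply/negP.
by move=> /B_edge/esetP.
Qed.

Let N_gt1 : (1 < N)%N := H_N H_1.

Let rv := rvec B N z.
Let lv := lvec B N z.
Let S := total_mass B N z.

Let S_gt0 : 0 < S.
Proof. exact: total_mass_gt0. Qed.

Let rv_eigen w : z * \sum_(y < N) B w y * rv y = rv w.
Proof. exact: (rvec_eigen B_ge0 adj_N adj_up z_root w). Qed.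

Let lv_eigen w : z * \sum_(y < N) B y w * lv y = lv w.
Proof. exact: (lvec_eigen B_ge0 adj_N adj_up z_root N_gt1 w). Qed.

Let rv_ge0 w : 0 <= rv w.
Proof. exact: rvec_ge0. Qed.

Let lv_ge0 w : 0 <= lv w.
Proof. exact: lvec_ge0. Qed.

Let lv_off w : ~ vset H w -> lv w = 0.
Proof.
move=> nw; rewrite -lv_eigen big1 ?mulr0 // => y _.
by rewrite adj_off ?mul0r //; case.
Qed.

Let path_gt0 x s : path (edge_rel H) x s -> path (fun x y => 0 < B x y) x s.
Proof. by apply: sub_path => a b /set_mem/B_edge. Qed.

Let rv_gt0 w : vset H w -> 0 < rv w.
Proof.
move=> Hw; have /is_path_relP[y [s [ps sw]]] := H_conn Hw H_1.
exact: (rvec_gt0 B_ge0 adj_N adj_up z_gt0 z_root (path_gt0 ps)).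
Qed.

Let lv_gt0 w : vset H w -> 0 < lv w.
Proof.
move=> Hw; have /is_path_relP[y [s [ps sw]]] := H_conn H_1 Hw.
have := lvec_gt0 B_ge0 adj_N adj_up z_gt0 z_root N_gt1 (path_gt0 ps).
by rewrite lvec1 ltr01 /= sw; apply.
Qed.

Lemma fsum_vset (V : nmodType) (F : nat -> V) : (forall w, ~ vset H w -> F w = 0) ->
  \sum_(w \in vset H) F w = \sum_(w < N) F w.
Proof.
move=> F0; rewrite fsbig_ord; apply: fsbig_widen => [w /H_N //|w [_ /F0]].
by [].
Qed.

(** An eigenvalue c with eigenvector x satisfies |c| |x| <= A |x| entrywise;
    pairing with the positive left eigenvector gives |c| <= 1/z. *)
Lemma perron_root : perron_eigenvalue H W z^-1.
Proof.
have z0 : z != 0 by rewrite gt_eqF.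
split; first by rewrite invr_gt0.
- exists (fun w => real_complex R (rv w)); split.
    by exists 1%N => //; rewrite /rv rvec1 rmorph1 oner_neq0.
  move=> u Hu; rewrite fsum_vset => [|w nw]; last first.
    by rewrite adj_off ?rmorph0 ?mul0r //; case.
  under eq_bigr do rewrite -rmorphM.
  by rewrite -rmorph_sum -rmorphM -[rv u]rv_eigen mulKf.
- move=> c [x [[u Hu xu] xE]].
  pose T := \sum_(w < N) real_complex R (lv w) * `|x w|.
  have lvc w : 0 <= real_complex R (lv w) by rewrite ler0c.
  have T0 : 0 < T.
    rewrite /T (bigD1 (Ordinal (H_N Hu))) //= ltr_pwDl //.
      by rewrite mulr_gt0 ?normr_gt0 // ltcR lv_gt0.
    by apply: sumr_ge0 => w _; rewrite mulr_ge0.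
  rewrite -(ler_pM2r T0).
  have -> : `|c| * T = \sum_(w < N)
      real_complex R (lv w) * `|\sum_(y < N) real_complex R (B w y) * x y|.
    rewrite /T mulr_sumr; apply: eq_bigr => w _.
    have [Hw|nw] := pselect (vset H w); last by rewrite lv_off // rmorph0 !mul0r mulr0.
    rewrite mulrCA -normrM -xE // fsum_vset // => y ny.
    by rewrite adj_off ?rmorph0 ?mul0r //; case.
  apply: le_trans (_ : \sum_(w < N) \sum_(y < N)
      real_complex R (lv w) * (real_complex R (B w y) * `|x y|) <= _).
    apply: ler_sum => w _; rewrite -mulr_sumr ler_wpM2l //.
    apply: le_trans (ler_norm_sum _ _ _) _; apply: ler_sum => y _.
    by rewrite normrM ger0_norm // ler0c.
  rewrite exchange_big /= /T mulr_sumr le_eqVlt; apply/orP; left; apply/eqP.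
  apply: eq_bigr => y _; rewrite mulrA -rmorphM.
  rewrite -[in RHS](lv_eigen y) mulKf // rmorph_sum mulr_suml.
  by apply: eq_bigr => w _; rewrite mulrA -rmorphM mulrC [lv _ * _]mulrC mulrC.
Qed.

(** As mu is carried by the paths of H, a cylinder of a larger graph G has the
    measure of the corresponding cylinder of H, which is at most the stationary
    probability of its first vertex. *)
Lemma equilibrium_exists : exists mu : probability path_space R,
  equilibrium_measure H W mu /\
  forall G s t u, subgraph H G -> (mu (cylinder G s t u) <=
    (lvec B N z (u 0%N) * rvec B N z (u 0%N) / total_mass B N z)%:E)%E.
Proof.
pose l w := lv w / S.
have l_ge0 w : 0 <= l w by rewrite divr_ge0 // ltW.
have l_off w : ~ vset H w -> l w = 0 by move=> nw; rewrite /l lv_off // mul0r.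
have l_N w : (N <= w)%N -> l w = 0.
  by move=> Nw; apply: l_off => /H_N; rewrite ltnNge Nw.
have l_eigen w : z * \sum_(y < N) B y w * l y = l w.
  rewrite /l; under eq_bigr do rewrite mulrA.
  by rewrite -mulr_suml mulrA lv_eigen.
have lr1 : \sum_(w < N) l w * rv w = 1.
  rewrite /l; under eq_bigr do rewrite mulrAC.
  by rewrite -mulr_suml divff // gt_eqF.
pose mu := markov_measure B_ge0 l_ge0 rv_ge0 z_gt0 rv_eigen l_eigen lr1.
have admissibleE : admissible_paths B = Omega H.
  by apply/seteqP; split => omega Ho i; apply/B_edge; exact: Ho.
have cylE a k u := markov_measure_cylinder B_ge0 adj_N l_ge0 rv_ge0 l_N z_gt0
  rv_eigen l_eigen lr1 a k u.
have movI A : mu (Omega H `&` A) = mu A.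
  by rewrite -admissibleE; exact: markov_measure_admissible.
have z0 : z != 0 by rewrite gt_eqF.
exists mu; split; [split|].
- by rewrite -(setIT (Omega H)) movI probability_setT.
- exists z^-1, l, rv; split.
  + exact: perron_root.
  + by move=> u Hu; rewrite divr_gt0 ?lv_gt0 ?rv_gt0.
  + move=> w Hw; split.
      rewrite fsum_vset => [|u /l_off ->]; last by rewrite mul0r.
      by rewrite -[in RHS]l_eigen mulKf //; apply: eq_bigr => u _; rewrite mulrC.
    rewrite fsum_vset => [|u nu]; last by rewrite adj_off ?mul0r //; case.
    by rewrite -[in RHS]rv_eigen mulKf.
  + by rewrite fsum_vset // => u /l_off ->; rewrite mul0r.
  + by move=> s t u _; rewrite [LHS]movI [LHS]cylE exprVn invrK.
- move=> G s t u [_ HG].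
  apply: le_trans (_ : mu (coord_cylinder s 0 u) <= _)%E; last first.
    rewrite [leLHS]cylE /markov_weight big_ord0 expr0 mul1r mulr1 lee_fin.
    by rewrite /l -/(rv _) mulrAC.
  rewrite -[leLHS]movI.
  rewrite (_ : Omega H `&` _ = Omega H `&` coord_cylinder s t u).
    rewrite movI; apply: le_measure; rewrite ?inE; try exact: measurable_coord_cylinder.
    by move=> omega Ho i; rewrite leqn0 => /eqP ->; exact: Ho.
  apply/seteqP; split => omega [Ho]; first by case.
  by move=> Co; split => //; split => // i; exact/HG/Ho.
Qed.

End Equilibrium.

(** * Loss of mass along the subgraphs G_{n,m} *)

Section SmallCylinders.
Variables (R : realType) (G : digraph) (W : nat * nat -> R) (D : nat -> nat).
Hypothesis linG : locally_bounded_linear G D.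
Hypothesis W_gt0 : forall e, eset G e -> 0 < W e.

Local Notation A := (adj G W).

Let edgeG x y : eset G (x, y) -> [/\ (0 < x)%N, y = 1%N \/ (x < y)%N & (y < D x)%N].
Proof. by case: linG => _ + _ _; apply. Qed.

Let A_ge0 : forall x y, 0 <= A x y.
Proof. exact: adj_ge0. Qed.

Let A_edge x y : 0 < A x y <-> eset G (x, y).
Proof. exact: adj_gt0. Qed.

Let A_D x y : 0 < A x y -> (y < D x)%N.
Proof. by move=> /A_edge/edgeG[]. Qed.

Let A_next w : (0 < w)%N -> 0 < A w w.+1.
Proof. by move=> w0; apply/A_edge; case: linG => _ _ /(_ _ w0)[]. Qed.

Let A_home w : (0 < w)%N -> 0 < A w 1.
Proof. by move=> w0; apply/A_edge; case: linG => _ _ /(_ _ w0)[]. Qed.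

Let A_0l y : A 0 y = 0.
Proof.
apply/eqP; rewrite eq_le A_ge0 andbT leNgt; apply/negP.
by move=> /A_edge/edgeG[].
Qed.

(** R_u is the radius of convergence at the vertex 1 as well, which is expressed
    here by the size of the terms beyond it, and the return series of 1 does not
    exceed 1 there. *)
Lemma critical_radius : (forall u, vset G u -> (0 < conv_radius G W u)%E) ->
  unstable_positive G W ->
  exists2 r : R, 0 < r & (forall N, retsum A D 1 r N <= 1) /\
    forall z m0, r < z -> exists2 m, (m0 <= m)%N & 1 < ret A D 1 m * z ^+ m.+1.
Proof.
move=> cr [_ [u Gu [r [crE Phi1 _]]]].
have u0 : (0 < u)%N by case: linG => /(_ u)[+ _ _ _ _]; apply.
have r0 : 0 < r by have := cr u Gu; rewrite crE lte_fin.
have K_D x y : eset G (x, y) -> (y < D x)%N by move=> /edgeG[].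
have Hr N : retsum A D u r N <= 1.
  by rewrite -lee_fin -Phi1 retsum_le_Phi // ltW.
have Hz z C : r < z -> exists N, C < retsum A D u z N.
  move=> rz; apply: contrapT => noN; have z0 : 0 <= z by rewrite ltW // (lt_trans r0).
  have PC : (Phi G W u z <= C%:E)%E.
    apply: (Phi_le K_D W_gt0 z0) => N; rewrite leNgt; apply/negP => ?.
    by apply: noN; exists N.
  have : (z%:E <= conv_radius G W u)%E.
    apply: ereal_sup_ubound; exists z => //; split => //.
    exact: le_lt_trans PC (ltry _).
  by rewrite crE lee_fin leNgt rz.
exists r => //; split.
  exact: (retsum_le1_home A_ge0 A_D A_next A_home A_0l u0 r0 Hr).
move=> z m0 rz; apply: (ret_large A_ge0 r0 _ m0 rz) => z' C.
exact: (retsum_unbounded_home A_ge0 A_D A_next A_home A_0l u0 r0 Hr Hz).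
Qed.

Lemma ret_gt0 n : 0 < ret A D 1 n.
Proof.
suff H w : (0 < w)%N -> 0 < step A D (hit A D 1 n) w by exact: H.
elim: n w => [|n IH] w w0.
  apply: lt_le_trans (le_step1 A_ge0 (@hit_ge0 _ _ _ A_ge0 _ _) (A_D (A_home w0))).
  by rewrite /= mulr1 A_home.
apply: lt_le_trans (le_step1 A_ge0 (@hit_ge0 _ _ _ A_ge0 _ _) (A_D (A_next w0))).
by rewrite /= eqSS gtn_eqF // mulr_gt0 ?A_next // IH.
Qed.

Lemma Gnm_chain_edges n m w : (0 < w <= n)%N ->
  eset (Gnm G n m) (w, 1%N) /\ forall i, (0 < i < w)%N -> eset (Gnm G n m) (i, i.+1).
Proof.
move=> /andP[w0 wn]; have [cp cl] := chain_path linG w.-1; rewrite prednK // in cl.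
have cyc : simple_cycles G 1 w (1%N, rcons (iota 2 w.-1) 1%N).
  have := @simple_cycle_rcons G 1 (iota 2 w.-1); rewrite size_iota prednK //; apply.
    by rewrite rcons_path cp cl; apply/mem_set/A_edge/A_home.
  exact: one_notin_iota.
have vis i : (i < w)%N -> nth 0%N (visited (1%N, rcons (iota 2 w.-1) 1%N)) i = i.+1.
  move=> iw; rewrite /visited /= -rcons_cons.
  have -> : 1%N :: iota 2 w.-1 = iota 1 w by case: (w) w0.
  by rewrite nth_rcons size_iota iw nth_iota.
have len : path_length (1%N, rcons (iota 2 w.-1) 1%N) = w.
  by rewrite /path_length size_rcons size_iota prednK.
split=> [|i /andP[i0 iw]]; apply/mem_Gnm; exists (1%N, rcons (iota 2 w.-1) 1%N), w;
  split=> //; try (by left); apply/path_edgesP.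
  exists w.-1; first by rewrite len prednK.
  rewrite vis ?prednK //; congr pair.
  by rewrite /visited /= -rcons_cons nth_rcons /= size_iota prednK // ltnn eqxx.
exists i.-1; first by rewrite len; lia.
by rewrite !vis ?prednK //; lia.
Qed.

Section Subgraph.
Variables (n m : nat).
Hypothesis n_gt0 : (0 < n)%N.

Local Notation H := (Gnm G n m).
Local Notation B := (adj H W).
Local Notation N := ((reach D (maxn n m)) + m).+2.
Local Notation bN := (fun _ : nat => N).

Let HG e : eset H e -> eset G e.
Proof. by case: (Gnm_subgraph G n m) => _; apply. Qed.

Let WH e : eset H e -> 0 < W e.
Proof. by move=> /HG/W_gt0. Qed.

Let B_ge0 : forall x y, 0 <= B x y.
Proof. exact: adj_ge0. Qed.

Let B_edge x y : 0 < B x y <-> eset H (x, y).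
Proof. exact: adj_gt0. Qed.

Let H_N x : vset H x -> (x < N)%N.
Proof. by move=> /(Gnm_vertex_bound linG); lia. Qed.

Let B_A x y : B x y <= A x y.
Proof.
rewrite /adj; case: ifP => [/set_mem/HG/mem_set ->//|_].
by case: ifP => // /set_mem/W_gt0/ltW.
Qed.

Let B_D x y : 0 < B x y -> (y < D x)%N.
Proof. by move=> /B_edge/HG/edgeG[]. Qed.

Let B_N x y : 0 < B x y -> (y < N)%N.
Proof. by move=> /B_edge/esetP[_ /H_N]. Qed.

Lemma ret_Gnm_le t : ret B bN 1 t <= ret A D 1 t.
Proof. by rewrite (@ret_eq_bound _ B bN D) // ret_le. Qed.

Hypothesis n_lt_m : (n < m)%N.

(** The cycles of length m of G are those of G_{n,m}. *)
Lemma ret_Gnm_eq : ret B bN 1 m.-1 = ret A D 1 m.-1.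
Proof.
have m0 : (0 < m)%N by exact: leq_ltn_trans n_lt_m.
have HN x y : eset H (x, y) -> (y < N)%N by move=> /B_edge/B_N.
have K_D x y : eset G (x, y) -> (y < D x)%N by move=> /edgeG[].
apply: EFin_inj; rewrite -(q_ret HN WH) -(q_ret K_D W_gt0) prednK //.
by rewrite /q_ simple_cycles_Gnm //; right.
Qed.

(** A cycle of length t + 1 returns to 1 from a vertex x with
    t < x <= reach t <= reach L < m, which by [Gnm_home] is possible only if
    x <= reach n, hence t < reach n. *)
Lemma ret_Gnm_gap t L : (reach D L < m)%N -> (reach D n <= t)%N -> (t <= L)%N ->
  ret B bN 1 t = 0.
Proof.
move=> Lm nt tL; apply/eqP; rewrite eq_le ret_ge0 ?andbT // leNgt; apply/negP => H0.
have D_homo : {homo D : x y / (x <= y)%N} by case: linG.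
have B_up x y : 0 < B x y -> y = 1%N \/ (x < y)%N by move=> /B_edge/HG/edgeG[].
have B_le x y : 0 < B x y -> (y <= D x)%N by move=> /B_D/ltnW.
have [x [tx xt /B_edge/(Gnm_home linG n_gt0)[xn|mx]]] :=
  step_hit_gt0 B_ge0 B_up D_homo B_le H0.
  by have := leq_trans tx xn; lia.
have : (reach D t <= reach D L)%N by exact: (reach_homo linG).
by move: xt; rewrite -/(reach D t); lia.
Qed.

(** Because of the gap, cycles of length at most L already have length at most
    [reach n], a bound independent of L and m. *)
Lemma retsum_Gnm_le z L : 0 <= z -> (reach D L < m)%N ->
  retsum B bN 1 z L <= retsum A D 1 z (reach D n).
Proof.
move=> z0 Lm; suff H L' : (L' <= L)%N ->
    retsum B bN 1 z L' <= retsum A D 1 z (minn L' (reach D n)).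
  apply: le_trans (H L (leqnn L)) _; apply: retsum_mono => //; exact: geq_minr.
elim: L' => [|L' IH] L'L; first by rewrite min0n !retsum0.
rewrite retsumS; have [nL|Ln] := leqP (reach D n) L'.
  rewrite (ret_Gnm_gap Lm nL (ltnW L'L)) mul0r addr0; apply: le_trans (IH (ltnW L'L)) _.
  by apply: retsum_mono => //; lia.
rewrite (minn_idPl Ln) retsumS lerD //.
  by have := IH (ltnW L'L); rewrite (minn_idPl (ltnW Ln)).
by rewrite ler_wpM2r ?exprn_ge0 ?ret_Gnm_le.
Qed.

Lemma chain_weight_Gnm r w : (0 < w <= n)%N -> chain_weight B r w = chain_weight A r w.
Proof.
move=> wn; have [home next] := Gnm_chain_edges m wn.
have adjE e : eset H e -> adj H W e.1 e.2 = adj G W e.1 e.2.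
  by case: e => x y /= He; rewrite /adj !mem_set //; exact: HG.
rewrite /chain_weight (adjE _ home) big_nat [in RHS]big_nat; congr (_ * _).
by apply: eq_bigr => i iw; rewrite (adjE _ (next i iw)).
Qed.

(** The root z of G_{n,m} lies between r and z1: above r because G_{n,m} has fewer
    cycles than G, and below z1 because at z1 the cycles of length m alone have
    weight more than 1.  Hence the short cycles of G_{n,m} have total probability
    at most 1 - eps, and the mean excursion is at least L eps. *)
Lemma Gnm_equilibrium (r z1 eps : R) L :
  0 < r -> (forall k, retsum A D 1 r k <= 1) -> r < z1 ->
  1 < ret A D 1 m.-1 * z1 ^+ m -> (reach D L < m)%N ->
  retsum A D 1 z1 (reach D n) <= 1 - eps -> n%:R <= L%:R * eps ->
  exists mu : probability path_space R, equilibrium_measure H W mu /\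
    forall s t u, (0 < u 0%N <= n)%N ->
      (mu (cylinder G s t u) <= ((chain_weight A r (u 0%N))^-1 / n%:R)%:E)%E.
Proof.
move=> r0 Hr rz1 big Lm Heps nL.
have m0 : (0 < m)%N by exact: leq_ltn_trans n_lt_m.
have home1 : eset H (1%N, 1%N) by case: (@Gnm_chain_edges n m 1) => //; rewrite n_gt0.
have ret0 : 0 < ret B bN 1 0.
  apply: lt_le_trans (le_step1 (y := 1%N) B_ge0 (@hit_ge0 _ _ _ B_ge0 _ _) _) => //.
  by rewrite /= mulr1; apply/B_edge.
have [z z0 zE] := @retsum_root R B bN B_ge0 1 N ret0.
have z00 := ltW z0.
have retsumBA y k : 0 <= y -> retsum B bN 1 y k <= retsum A D 1 y k.
  move=> y0; apply: ler_sum => t _; rewrite ler_wpM2r ?exprn_ge0 //; exact: ret_Gnm_le.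
have rz : r <= z.
  rewrite leNgt; apply/negP => zr.
  have := retsum_lt B_ge0 N ret0 z00 zr; rewrite zE ltNge.
  by rewrite (le_trans (retsumBA _ _ (ltW r0)) (Hr _)).
have zz1 : z <= z1.
  rewrite leNgt; apply/negP => z1z; move: big; apply/negP; rewrite -leNgt.
  rewrite -zE -ret_Gnm_eq.
  apply: le_trans (retsum_ge_term bN B_ge0 1 (t := m.-1) z00 _); last first.
    by rewrite prednK //; apply/leqW/leqW/leqW; exact: leq_addl.
  rewrite prednK // ler_wpM2l ?ret_ge0 // lerXn2r ?nnegrE ?(ltW z1z) //.
  by rewrite ltW // (lt_trans r0).
have H_up x y : eset H (x, y) -> y = 1%N \/ (x < y)%N by move=> /HG/edgeG[].
have [H1 _] := esetP home1.
have B_N' := adj_N WH H_N; have B_up := adj_up WH H_up.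
have [mu [eqmu muB]] := equilibrium_exists WH H_N H_up H1 (@Gnm_connected G n m) z0 zE.
exists mu; split=> // s t u un.
apply: le_trans (muB G s t u (Gnm_subgraph G n m)) _; rewrite lee_fin.
have S_ge : n%:R <= total_mass B N z.
  apply: le_trans nL _; apply: le_trans (total_mass_ge B_ge0 B_N' B_up z0 zE (H_N H1) L).
  rewrite ler_wpM2l //; have := retsum_Gnm_le z00 Lm.
  have := retsum_mono_z D A_ge0 1 (reach D n) z00 zz1; move: Heps; lra.
have n0 : 0 < n%:R :> R by rewrite ltr0n.
have [u0 _] := andP un.
have cw := chain_weight_le B_ge0 B_N' B_up z0 zE (H_N H1) r0 rz u0.
rewrite chain_weight_Gnm // in cw.
have c0 : 0 < chain_weight A r (u 0%N).
  rewrite /chain_weight mulr_gt0 // ?mulr_gt0 ?A_home // big_nat.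
  rewrite prodr_gt0 // => i /andP[i0 _].
  by rewrite mulr_gt0 // A_next.
apply: ler_pM => //.
- by apply: mulr_ge0; [exact: lvec_ge0|exact: rvec_ge0].
- by rewrite invr_ge0 (le_trans (ltW n0)).
- by rewrite -[leRHS]mul1r ler_pdivlMr // mulrC.
- by rewrite lef_pV2 // posrE (lt_le_trans n0).
Qed.

End Subgraph.

(** The order of the choices matters: n fixes the bound M on short cycles and the
    deficit eps, these fix L, and m is chosen last. *)
Lemma Gnm_cylinders_small r : 0 < r -> (forall k, retsum A D 1 r k <= 1) ->
  (forall z m0, r < z -> exists2 m, (m0 <= m)%N & 1 < ret A D 1 m * z ^+ m.+1) ->
  forall n, (0 < n)%N -> exists2 m, (n < m)%N &
  exists mu : probability path_space R, equilibrium_measure (Gnm G n m) W mu /\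
    forall s t u, (0 < u 0%N <= n)%N ->
      (mu (cylinder G s t u) <= ((chain_weight A r (u 0%N))^-1 / n%:R)%:E)%E.
Proof.
move=> r0 Hr big n n0; have r00 := ltW r0.
pose M := reach D n; pose eps := (1 - retsum A D 1 r M) / 2.
(* The cycle 1, 2, ..., M + 1, 1 has positive weight, so the partial sum up to M
   misses 1. *)
have eps0 : 0 < eps.
  rewrite divr_gt0 // subr_gt0; apply: lt_le_trans (Hr M.+1).
  by rewrite retsumS ltrDl mulr_gt0 ?exprn_gt0 ?ret_gt0.
have [L nL] : exists L : nat, n%:R <= L%:R * eps.
  exists (Num.bound (n%:R / eps)); rewrite -ler_pdivrMr //.
  by rewrite ltW // archi_boundP // divr_ge0 // ltW.
pose K := retsum A D 1 (r + 1) M.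
have K0 : 0 <= K by rewrite retsum_ge0 // addr_ge0.
pose th := eps / (eps + K).
have eK : 0 < eps + K by rewrite ltr_wpDr.
have th0 : 0 < th by rewrite divr_gt0.
have th1 : th <= 1 by rewrite ler_pdivrMr // mul1r lerDl.
have thK : th * K <= eps.
  rewrite /th mulrAC ler_pdivrMr // mulrDr lerDr.
  by rewrite mulr_ge0 // ltW.
have rr1 : r <= r + 1 by rewrite lerDl.
(* Half of the deficit at r is given up in moving to r + th, by convexity. *)
have Heps : retsum A D 1 (r + th) M <= 1 - eps.
  have th01 : 0 <= th <= 1 by rewrite ltW.
  have := retsum_convex D A_ge0 1 M r00 rr1 th01; rewrite addrAC subrr add0r mulr1.
  rewrite -/K; have : 0 <= th * retsum A D 1 r M.
    by rewrite mulr_ge0 ?(ltW th0) ?retsum_ge0.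
  by move: thK; rewrite /eps; lra.
have rth : r < r + th by rewrite ltrDl.
have [m mm mbig] := big _ (maxn n (reach D L)) rth.
have /andP[nm Lm] : (n <= m)%N && (reach D L <= m)%N by rewrite -geq_max.
exists m.+1; first by rewrite ltnS.
by apply: (@Gnm_equilibrium n m.+1 n0 _ r (r + th) eps L); rewrite ?ltnS.
Qed.

End SmallCylinders.

Theorem theorem4p5 (R : realType) (G : digraph) (W : nat * nat -> R)
    (hG : linear_graph G) (hW : loaded_graph G W)
    (hup : unstable_positive G W) :
  exists n : nat -> nat,
    (0 < n 0)%N /\
    (forall k, (n k < n k.+1)%N) /\
    irregular G W (fun k => Gnm G (n k) (n k.+1)).
Proof.
have [D linG] := linear_graph_bounded hG; have [W_gt0 conv] := hW.
have [r r0 [Hr big]] := critical_radius linG W_gt0 conv hup.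
pose P n m := (n < m)%N /\ exists mu : probability path_space R,
  equilibrium_measure (Gnm G n m) W mu /\ forall s t u, (0 < u 0%N <= n)%N ->
  (mu (cylinder G s t u) <= ((chain_weight (adj G W) r (u 0%N))^-1 / n%:R)%:E)%E.
have next n : exists m, (0 < n)%N -> P n m.
  have [->|n0] := posnP n; first by exists 0%N.
  by have [m nm H] := Gnm_cylinders_small linG W_gt0 r0 Hr big n0; exists m => _; split.
have [g gP] := choice next.
pose n k := iter k g 1%N.
have n_ge k : (k < n k)%N.
  elim: k => // k IH; have [] := gP (n k) (leq_ltn_trans (leq0n k) IH).
  by move=> lt _; exact: leq_ltn_trans IH lt.
have nP k : P (n k) (n k.+1) by apply: gP; exact: leq_ltn_trans (n_ge k).
have n_lt k : (n k < n k.+1)%N by case: (nP k).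
exists n; split => //; split => //; split.
- exact: (@Gnm_exhaustive _ _ linG n n_lt).
- by move=> k; split; [exact: Gnm_finite linG _ _|exact: Gnm_connected].
have [mu muP] := choice (fun k => (nP k).2).
exists mu; split=> [k|s t u]; first by case: (muP k).
(* 0 is not a vertex, so the cylinder is empty if it starts there. *)
have [u0|u0] := posnP (u 0%N).
  suff -> : (fun k => mu k (cylinder G s t u)) = cst 0%E by exact: cvg_cst.
  apply/funext => k; rewrite [X in mu k X](_ : _ = set0) ?measure0 //.
  apply/seteqP; split => // omega [Go Co].
  have [_ edges _ _] := linG.
  by have := Go (s + 0%:Z); rewrite Co // u0 => /edges[].
pose c := (chain_weight (adj G W) r (u 0%N))^-1.
(* The bound c / n k applies as soon as n k >= u 0, and n k > k. *)
apply: (@squeeze_cvge _ _ _ _ (cst 0%E) _ (fun k => (c * harmonic k)%:E)).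
- exists (u 0%N) => // k /= uk; rewrite measure_ge0 /=.
  have [_ muB] := muP k.
  apply: le_trans (muB s t u _) _; first by rewrite u0 (leq_trans uk (ltnW (n_ge k))).
  have c0 : 0 <= c.
    rewrite invr_ge0 /chain_weight mulr_ge0 ?prodr_ge0 // => *.
      by rewrite mulr_ge0 ?adj_ge0 // ltW.
    by rewrite mulr_ge0 ?adj_ge0 // ltW.
  rewrite lee_fin ler_wpM2l // /harmonic lef_pV2 ?posrE ?ltr0n //.
    by rewrite ler_nat.
  exact: leq_ltn_trans (n_ge k).
- exact: cvg_cst.
- apply: cvg_EFin; first by apply: nearW.
  rewrite -(mulr0 c); apply: cvgM; [exact: cvg_cst|exact: cvg_harmonic].
Qed.
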